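(* For any $K>0$ there exist $d\in\mathbb{N}$, a closed 1-unconditional convex body $G\subseteq\mathbb{R}^d$ in isotropic position, and a function $f:\mathbb{Z}^d\to\mathbb{C}$, not identically zero and belonging to $\ell^p(\mathbb{Z}^d)$ for all $p\in(1,\infty)$, such that for all $p\in(1,\infty)$ $$\Big\|\sup_{n\in\mathbb{Z},\ \widetilde{\kappa}(2^nG)\le d^{-1/2}}|\mathcal{M}_{2^n}^Gf|\Big\|_{\ell^p(\mathbb{Z}^d)}\ge\frac16K^{1/p}\|f\|_{\ell^p(\mathbb{Z}^d)}.$$
   Context: A convex body in $\mathbb{R}^d$ is a closed, bounded, convex set with non-empty interior. It is 1-unconditional if it is invariant under all coordinate sign changes $x\mapsto(\epsilon_1x_1,\dots,\epsilon_dx_d)$, $\epsilon\in\{-1,1\}^d$. $G$ is in isotropic position if there is $L(G)>0$ with $\frac1{|G|}\int_Gx_ix_j\,dx=\delta_j^iL(G)^2$ for all $i,j\in\{1,\dots,d\}$, where $|G|$ is the volume (no volume normalization is required). $|x|_1=\sum_{i=1}^d|x_i|$; for a symmetric convex body, $\widetilde{\kappa}(G)=\max_{x\in G\cap\mathbb{Z}^d}|x|_1/d$; $tG=\{tx:x\in G\}$. For $f:\mathbb{Z}^d\to\mathbb{C}$ and $t>0$, $$\mathcal{M}_t^Gf(x)=\frac{1}{|tG\cap\mathbb{Z}^d|}\sum_{y\in tG\cap\mathbb{Z}^d}f(x-y),\qquad x\in\mathbb{Z}^d,$$ where $|tG\cap\mathbb{Z}^d|$ denotes cardinality. *)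

(* Defs.v *)
From HB Require Import structures.
From mathcomp Require Import all_boot all_order all_algebra.
From mathcomp Require Import finmap.
From mathcomp Require Import all_classical all_reals all_analysis.
From mathcomp Require Import complex.

Set Implicit Arguments.
Unset Strict Implicit.
Unset Printing Implicit Defensive.

Import Order.TTheory GRing.Theory Num.Theory.
Import numFieldNormedType.Exports.

Local Open Scope classical_set_scope.
Local Open Scope ring_scope.

(** Lebesgue measure on [R]^d, as the iterated product of the one-dimensional
    Lebesgue measure. The library has no such measure; its sigma-algebra on
    [d.-tuple R] is the product of the Borel sigma-algebras. *)
Section LebesgueTuple.
Context {R : realType}.
Local Notation tupleR n := (n.-tuple (measurableTypeR R)).
Local Notation leb1 := (@lebesgue_measure R).
Local Open Scope ereal_scope.

Definition tuple_cons n (xv : measurableTypeR R * tupleR n) : tupleR n.+1 :=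
  cons_tuple xv.1 xv.2.

Lemma measurable_tuple_cons n :
  measurable_fun [set: measurableTypeR R * tupleR n] (@tuple_cons n).
Proof. exact: measurable_cons measurable_fst measurable_snd. Qed.

Fixpoint lebesgue_tuple n : set (tupleR n) -> \bar R :=
  match n with
  | 0 => \d_([tuple] : tupleR 0)
  | n.+1 => pushforward (leb1 \x lebesgue_tuple (n := n)) (@tuple_cons n)
  end.

Let lebesgue_tuple_sfm n :
  exists m : {sigma_finite_measure set (tupleR n) -> \bar R},
    (m : set (tupleR n) -> \bar R) = @lebesgue_tuple n.
Proof.
elim: n => [|n [m IH]]; first by exists (\d_([tuple] : tupleR 0)).
pose mu : {measure set (tupleR n.+1) -> \bar R} :=
  measure_function_pushforward__canonical__measure_function_Measure
    (leb1 \x m) (@measurable_tuple_cons n).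
have sf : sigma_finite setT mu.
  have /sigma_finiteP[F [TF ndF Foo]] := sigma_finiteT leb1.
  have /sigma_finiteP[G [TG ndG Goo]] := sigma_finiteT m.
  pose g (t : tupleR n.+1) := (thead t, [tuple of behead t] : tupleR n).
  have gK : g \o @tuple_cons n = id.
    by apply/funext => -[x v] /=; congr (_, _); apply/val_inj.
  have mg : measurable_fun setT g.
    by apply: measurable_fun_pair; [exact: measurable_tnth|
                                    exact: measurable_behead].
  exists (fun k => g @^-1` (F k `*` G k)).
    rewrite -preimage_bigcup (_ : \bigcup_k _ = setT) ?preimage_setT//.
    apply/seteqP; split => // -[x y] _.
    have [k _ Fx] : (\bigcup_k F k) x by rewrite -TF.
    have [l _ Gy] : (\bigcup_k G k) y by rewrite -TG.
    exists (maxn k l) => //; split => /=.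
      by move: x Fx; apply/subsetPset/ndF/leq_maxl.
    by move: y Gy; apply/subsetPset/ndG/leq_maxr.
  move=> k; have [mF Fk] := Foo k; have [mG Gk] := Goo k; split.
    by rewrite -[X in measurable X]setTI; apply: mg => //; exact: measurableX.
  rewrite /mu /= /pushforward -comp_preimage gK preimage_id.
  by rewrite product_measure1E// lte_mul_pinfty// ge0_fin_numE.
pose H := Measure_isSigmaFinite.Build _ _ _ mu sf.
pose nu : {sigma_finite_measure set (tupleR n.+1) -> \bar R} :=
  HB.pack (Measure.sort mu) H.
by exists nu; rewrite /= -IH.
Qed.

Section measure_instance.
Variable n : nat.

Let lebesgue_tuple0 : @lebesgue_tuple n set0 = 0.
Proof. by have [m <-] := lebesgue_tuple_sfm n; exact: measure0. Qed.

Let lebesgue_tuple_ge0 A : 0 <= @lebesgue_tuple n A.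
Proof. by have [m <-] := lebesgue_tuple_sfm n; exact: measure_ge0. Qed.

Let lebesgue_tuple_sigma_additive : semi_sigma_additive (@lebesgue_tuple n).
Proof.
by have [m <-] := lebesgue_tuple_sfm n; exact: measure_semi_sigma_additive.
Qed.

HB.instance Definition _ := isMeasure.Build _ _ _ (@lebesgue_tuple n)
  lebesgue_tuple0 lebesgue_tuple_ge0 lebesgue_tuple_sigma_additive.

Let lebesgue_tuple_sigma_finite : sigma_finite setT (@lebesgue_tuple n).
Proof. by have [m <-] := lebesgue_tuple_sfm n; exact: sigma_finiteT. Qed.

HB.instance Definition _ := Measure_isSigmaFinite.Build _ _ _
  (@lebesgue_tuple n) lebesgue_tuple_sigma_finite.

End measure_instance.

Lemma lebesgue_tuple_box n (A : 'I_n -> set (measurableTypeR R)) :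
  (forall i, measurable (A i)) ->
  lebesgue_tuple [set t : tupleR n | forall i, A i (tnth t i)] =
  \prod_(i < n) leb1 (A i).
Proof.
elim: n A => [|n IH] A mA.
  by rewrite big_ord0 /= diracE mem_set// => -[].
rewrite big_ord_recl -IH// -product_measure1E//.
  congr ((leb1 \x _) _); apply/seteqP; split => -[x v] /=.
    by move=> Axv; split => [|i]; [exact: (Axv ord0)|
      have := Axv (lift ord0 i); rewrite /tuple_cons tnthS].
  move=> [Ax Av] i; have [->//|i0] := eqVneq i ord0.
  have [j ->] : exists j, i = lift ord0 j.
    by case: (unliftP ord0 i) i0 => [j ->|->]; [exists j|rewrite eqxx].
  by rewrite /tuple_cons tnthS; exact: Av.
rewrite [X in measurable X](_ : _ =
  \big[setI/setT]_(i < n) ((@tnth _ _)^~ i @^-1` A (lift ord0 i))).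
  apply: bigsetI_measurable => i _.
  by rewrite -[X in measurable X]setTI; exact: measurable_tnth.
apply/seteqP; split => t; rewrite -bigcap_seq/=.
  by move=> At i _; exact: At.
by move=> At i; apply: At; rewrite /= mem_index_enum.
Qed.

End LebesgueTuple.

Section Bodies.
Context {R : realType} (d : nat).
Implicit Types G : set 'rV[R]_d.

Definition row_of_tuple (t : d.-tuple (measurableTypeR R)) : 'rV[R]_d :=
  \row_i tnth t i.

Definition volume G : \bar R := lebesgue_tuple (row_of_tuple @^-1` G).

Definition convex_body G :=
  [/\ closed G, bounded_set G, convex_set G & G° !=set0].

Definition unconditional G :=
  forall eps : 'I_d -> bool,
    [set (\row_i ((-1) ^+ eps i * x ord0 i) : 'rV[R]_d) | x in G] = G.

Definition isotropic G :=
  exists2 L : R, 0 < L & forall i j : 'I_d,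
    (((fine (volume G))^-1)%:E *
     \int[@lebesgue_tuple R d]_(x in row_of_tuple @^-1` G)
       (tnth x i * tnth x j)%:E = ((i == j)%:R * L ^+ 2)%:E)%E.

Definition dilate (t : R) G : set 'rV[R]_d := [set t *: x | x in G].

Definition lattice_points G : set 'rV[int]_d :=
  [set y | G (map_mx intr y)].

(** The supremum is attained when [G] is bounded and contains 0. *)
Definition kappa_tilde G : R :=
  sup [set (\sum_(i < d) `|(y ord0 i)%:~R|) / d%:R | y in lattice_points G].

(** [fset_set A] lists the elements of [A] when [A] is finite, which holds for
    the lattice points of any bounded set. *)
Definition discrete_avg G (t : R) (f : 'rV[int]_d -> R[i])
    (x : 'rV[int]_d) : R[i] :=
  let A := fset_set (lattice_points (dilate t G)) in
  #|` A|%:R^-1 * \sum_(y <- A) f (x - y).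

Definition lp_norm (p : R) (F : 'rV[int]_d -> \bar R) : \bar R :=
  ((\esum_(x in [set: 'rV[int]_d]) `|F x| `^ p) `^ p^-1)%E.

Definition cmod (f : 'rV[int]_d -> R[i]) (x : 'rV[int]_d) : \bar R :=
  (Normc.normc (f x))%:E.

Definition dyadic_small_maximal G (f : 'rV[int]_d -> R[i])
    (x : 'rV[int]_d) : \bar R :=
  ereal_sup [set cmod (discrete_avg G (2 ^ n) f) x | n in
    [set n : int | kappa_tilde (dilate (2 ^ n) G) <= d%:R `^ (- 2^-1)]].

End Bodies.

(* Main.v *)
Require Import Defs.
From HB Require Import structures.
From mathcomp Require Import all_boot all_order all_algebra.
From mathcomp Require Import finmap.
From mathcomp Require Import all_classical all_reals all_analysis.
From mathcomp Require Import measurable_realfun beta_distribution.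
From mathcomp Require Import complex ring lra zify.

(** Take a bipyramid [sum |y_i| + max |z_l| <= 1] with few needle coordinates
    [y_i] and very many coordinates [z_l], and cut it by
    [sum lam_i |y_i| <= 1] with [lam_i] a power of 2. Before the cut all the
    moments are Dirichlet integrals, and all the [y_i] have the same tiny
    variance. By Markov's inequality the cut changes the moments by a factor
    arbitrarily close to 1. So the linear map that makes the cut body isotropic
    is almost a multiple of the identity on the [y_i], and since the [lam_i]
    are integers, rounding shows that the lattice points of the [2^k]-dilate
    are exactly the integer points with [z = 0] and
    [sum lam_i |y_i| <= 2^k].

    Group the needles into blocks, [lam_i = 2^k] on block [k]. A lattice point
    of the [2^k]-dilate is either [+e_i] or [-e_i] with [i] in block [k], or it
    is supported on the earlier blocks; choosing block [k] large, at least a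
    third of the lattice points are of the form [+e_i], and as many [-e_i].
    Let [f] be the indicator of the points of the cube [{0,1}^m] having an even
    number of ones in each block. At a point of the cube with an odd number of
    ones in block [k] only, each [i] in block [k] gives a step back into the
    support of [f], so the average of [f] at scale [2^k] is at least 1/3. These
    sets are disjoint for the different [k] and as large as the support. *)

Set Implicit Arguments.
Unset Strict Implicit.
Unset Printing Implicit Defensive.

Import Order.TTheory GRing.Theory Num.Theory.
Import numFieldNormedType.Exports.

Local Open Scope classical_set_scope.
Local Open Scope ring_scope.

(** * Lebesgue integrals over tuples *)

(** By uniqueness of Lebesgue measure: [|c|] times its image under [x => c * x] gives every
    half-open interval its length, so it is Lebesgue measure again, and [f] can be integrated
    against it. *)
Lemma ge0_integral_scale (R : realType) (c : R)
    (f : measurableTypeR R -> \bar R) :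
  c != 0 -> measurable_fun [set: measurableTypeR R] f ->
    (forall x, 0 <= f x)%E ->
  (\int[lebesgue_measure]_x f (c * x)%R =
    `|c|^-1%:E * \int[lebesgue_measure]_x f x)%E.
Proof.
move=> c0 mf f0.
have mphi : measurable_fun setT (fun x : measurableTypeR R =>
  c * x : measurableTypeR R)%R.
  exact: measurable_funM.
have c0' : 0 < `|c| by rewrite normr_gt0.
pose nu : {measure set (measurableTypeR R) -> \bar R} :=
  mscale (NngNum (normr_ge0 c))
  (measure_function_pushforward__canonical__measure_function_Measure
    lebesgue_measure mphi).
have nuE A : measurable A -> lebesgue_measure A = nu A.
  apply: lebesgue_measure_unique => _ [[a b]] _ <-.
  have -> : nu `]a, b]%classic =
    (`|c|%:E * lebesgue_measure ((fun x : measurableTypeR R => c * x)%R @^-1`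
      `]a, b]))%E by [].
  have [cp|cn|cc] := ltgtP c 0; last by rewrite cc eqxx in c0.
  (* A negative [c] reverses the interval: the preimage is now closed on the left and open on the
     right, still of length [(b - a) / |c|]. *)
  - rewrite (_ : _ @^-1` _ = `[b / c, a / c[%classic); last first.
      apply/seteqP; split=> x /=; rewrite !in_itv/= ler_ndivrMr// ltr_ndivlMr//.
        by rewrite ![x * c]mulrC andbC.
      by rewrite ![x * c]mulrC andbC.
    rewrite !lebesgue_measure_itv/= !lte_fin ltr_nM2r ?invr_lt0//.
    case: ifPn => ab; last by rewrite mule0.
    rewrite -EFinM ltr0_norm//; congr (_%:E); field; exact: c0.
  - rewrite (_ : _ @^-1` _ = `]a / c, b / c]%classic); last first.
      by apply/seteqP; split=> x /=; rewrite !in_itv/=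
        ler_pdivlMr// ltr_pdivrMr// ![x * c]mulrC.
    rewrite !lebesgue_measure_itv/= !lte_fin ltr_pM2r ?invr_gt0//.
    case: ifPn => ab; last by rewrite mule0.
    rewrite -EFinM gtr0_norm//; congr (_%:E); field; exact: c0.
rewrite [X in (_ * X)%E](_ : _ = \int[nu]_x f x)%E; last first.
  by apply: eq_measure_integral => /= A mA _; exact: nuE.
rewrite /nu ge0_integral_mscale//= ge0_integral_pushforward//= preimage_setT.
by rewrite muleA -EFinM mulVf ?mul1e// gt_eqF.
Qed.

Section lebesgue_tuple_integrals.
Context {R : realType}.
Local Notation T n := (n.-tuple (measurableTypeR R)).
Local Notation mu n := (@lebesgue_tuple R n).

Lemma integral_lebesgue_tuple0 (f : T 0 -> \bar R) :
  (forall t, 0 <= f t)%E -> (\int[mu 0]_t f t = f [tuple])%E.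
Proof.
move=> f0.
have mf : measurable_fun setT f.
  move=> _ Y mY; rewrite setTI.
  have [h|h] := pselect (Y (f [tuple])).
    by rewrite (_ : _ @^-1` _ = setT)//; apply/seteqP; split => // t _;
      rewrite /= (tuple0 t).
  by rewrite (_ : _ @^-1` _ = set0)//; apply/seteqP; split => // t /=;
    rewrite (tuple0 t).
rewrite /= integral_dirac// diracT mul1e//.
Qed.

Lemma integral_lebesgue_tupleS n (f : T n.+1 -> \bar R) :
  measurable_fun setT f -> (forall t, 0 <= f t)%E ->
  (\int[mu n.+1]_t f t =
   \int[lebesgue_measure]_x \int[mu n]_v f (tuple_cons (x, v)))%E.
Proof.
move=> mf f0.
rewrite /= ge0_integral_pushforward//=; last exact: measurable_tuple_cons.
rewrite preimage_setT fubini_tonelli1//.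
exact: measurableT_comp (@measurable_tuple_cons R n).
Qed.

Definition scale_tuple n (c : 'I_n -> R) (t : T n) : T n :=
  [tuple c i * tnth t i | i < n].

Lemma measurable_scale_tuple n (c : 'I_n -> R) :
  measurable_fun setT (scale_tuple c).
Proof.
apply/measurable_fun_tnthP => i.
rewrite (_ : _ \o _ = fun t : T n => c i * tnth t i); last first.
  by apply/funext => t /=; rewrite tnth_mktuple.
by apply: measurable_funM => //; exact: measurable_tnth.
Qed.

Lemma scale_tuple_cons n (c : 'I_n.+1 -> R) x (v : T n) :
  scale_tuple c (tuple_cons (x, v)) =
  tuple_cons (c ord0 * x, scale_tuple (fun i => c (lift ord0 i)) v).
Proof.
apply: eq_from_tnth => i; rewrite tnth_mktuple /tuple_cons.
by have [j ->|->] := unliftP ord0 i; rewrite ?tnthS ?tnth_mktuple// !tnth0.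
Qed.

(** Tonelli and induction: the induction hypothesis rescales the inner integral,
    [ge0_integral_scale] the outer one. *)
Lemma ge0_integral_scale_tuple n (c : 'I_n -> R) (f : T n -> \bar R) :
  (forall i, c i != 0) ->
  measurable_fun setT f -> (forall t, 0 <= f t)%E ->
  (\int[mu n]_t f (scale_tuple c t) = (\prod_i `|c i|^-1)%:E * \int[mu n]_t f
    t)%E.
Proof.
elim: n c f => [|n IH] c f c0 mf f0.
  rewrite !integral_lebesgue_tuple0// big_ord0 mul1e; congr f.
  by apply: eq_from_tnth => -[].
rewrite !integral_lebesgue_tupleS//; last first.
  exact: measurableT_comp (measurable_scale_tuple c).
have mx x : measurable_fun setT (fun v => f (tuple_cons (x, v))).
  apply: (measurableT_comp mf); apply: (measurableT_comp
    (@measurable_tuple_cons R n)).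
  exact: measurable_fun_pair.
under eq_integral => x _.
  under eq_integral do rewrite scale_tuple_cons.
  rewrite (IH (fun i => c (lift ord0 i)) (fun v =>
    f (tuple_cons (c ord0 * x, v))))//.
  over.
have mF : measurable_fun setT (fun x => \int[mu n]_v f (tuple_cons (x, v)))%E.
  apply: (@measurable_fun_fubini_tonelli_F _ _ _ _ _ (mu n)
    (f \o @tuple_cons R n)).
    exact: measurableT_comp (@measurable_tuple_cons R n).
  by move=> x; exact: f0.
pose G x := ((\prod_i `|c (lift ord0 i)|^-1)%:E *
   \int[mu n]_v f (tuple_cons (x, v)))%E.
transitivity (\int[lebesgue_measure]_x G (c ord0 * x)%R)%E => //.
rewrite ge0_integral_scale//; last 2 first.
- exact: measurable_funeM.
- by move=> x; rewrite /G mule_ge0 ?lee_fin ?prodr_ge0 ?integral_ge0// => i _;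
    rewrite invr_ge0.
rewrite /G ge0_integralZl//; last 2 first.
- by move=> x _; exact: integral_ge0.
- by rewrite lee_fin prodr_ge0// => i _; rewrite invr_ge0.
by rewrite muleA -EFinM big_ord_recl.
Qed.

End lebesgue_tuple_integrals.

(** * Beta integrals on the line *)

Section one_dimensional_integrals.
Context {R : realType}.
Implicit Types (s x : R) (a b : nat).

(** The truncated power with the convention 0^0 = 1: for [b = 0] it is the indicator of [0 <= s], so
    it encodes a closed constraint. *)
Definition pos_pow b s : R := if 0 <= s then s ^+ b else 0.

Lemma pos_pow_ge0 b s : 0 <= pos_pow b s.
Proof. by rewrite /pos_pow; case: ifPn => // s0; exact: exprn_ge0. Qed.

Lemma measurable_pos_pow b : measurable_fun [set: measurableTypeR R]
    (pos_pow b : measurableTypeR R -> R).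
Proof.
apply: measurable_fun_if => //.
- exact: (measurable_fun_ler (measurable_cst _) (@measurable_id _ _ _)).
Qed.

Lemma ge0_integral_even (f : measurableTypeR R -> \bar R) :
  measurable_fun [set: measurableTypeR R] f -> (forall x, 0 <= f x)%E ->
  (forall x, f (- x)%R = f x) ->
  (\int[lebesgue_measure]_x f x = 2%:E * \int[lebesgue_measure]_(x
    in `[0%R, +oo[) f x)%E.
Proof.
move=> mf f0 fe.
rewrite -(setUv `[0%R, +oo[%classic) ge0_integral_setU//=; last 2 first.
- by rewrite setUv.
- exact/disj_setPCl.
rewrite mule_natl mule2n; congr (_ + _)%E.
rewrite setCitvr integral_itv_bndo_bndc; last exact/measurable_funTS.
rewrite [RHS]ge0_integration_by_substitution0//.
  by apply: eq_integral => x _; rewrite fe.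
exact: measurableC.
Qed.

Lemma pos_powD a b s : pos_pow (a + b) s = pos_pow a s * pos_pow b s.
Proof. by rewrite /pos_pow; case: ifPn => _; rewrite ?mulr0// exprD. Qed.

Lemma measurable_abs_pow a b s : measurable_fun [set: measurableTypeR R]
  (fun x : measurableTypeR R => `|x| ^+ a * pos_pow b (s - `|x|)).
Proof.
apply: measurable_funM; first by apply: measurable_funX;
  exact: normr_measurable.
apply: (measurableT_comp (measurable_pos_pow b)).
by apply: measurable_funB => //; exact: normr_measurable.
Qed.

(** For [s > 0] the substitution [x = s * u] leaves the Beta integral B(a+1, b+1) = a! b! / (a+b+1)!
    on the unit interval; the factor 2 comes from evenness. *)
Lemma integral_abs_pow a b s :
  (\int[lebesgue_measure]_x (`|x| ^+ a * pos_pow b (s - `|x|))%:E =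
   ((2 * a`!%:R * b`!%:R / (a + b).+1`!%:R) * pos_pow (a + b).+1 s)%:E)%E.
Proof.
have mg r : measurable_fun [set: measurableTypeR R]
    (fun x : measurableTypeR R => (`|x| ^+ a * pos_pow b (r - `|x|))%:E).
  by apply/measurable_EFinP; exact: measurable_abs_pow.
have g0 r (x : R) : (0 <= (`|x| ^+ a * pos_pow b (r - `|x|))%:E)%E.
  by rewrite lee_fin mulr_ge0 ?exprn_ge0 ?pos_pow_ge0.
have [s0|s0|->] := ltgtP s 0.
- rewrite /pos_pow [in RHS]leNgt s0/= mulr0.
  apply: integral0_eq => x _; congr EFin.
  rewrite ifF ?mulr0//; apply/negbTE; rewrite -ltNge.
  by rewrite subr_lt0; apply: lt_le_trans s0 _.
- have := @ge0_integral_scale R s _ (lt0r_neq0 s0) (mg s) (g0 s).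
  rewrite gtr0_norm// => /(congr1 (fun z => s%:E * z)%E).
  rewrite muleA -EFinM divff ?gt_eqF// mul1e => <-.
  have E (x : R) : `|s * x| ^+ a * pos_pow b (s - `|s * x|) =
      s ^+ (a + b) * (`|x| ^+ a * pos_pow b (1 - `|x|)).
    rewrite normrM gtr0_norm// -{2}(mulr1 s) -mulrBr /pos_pow pmulr_rge0//
      !exprMn exprD.
    by case: ifPn => _; rewrite ?mulr0//; ring.
  under eq_integral do rewrite E EFinM.
  rewrite ge0_integralZl//; last by rewrite lee_fin exprn_ge0// ltW.
  rewrite ge0_integral_even//; last by move=> x; rewrite normrN.
  rewrite (_ : (\int[_]_(x in _) _)%E = (beta_fun a.+1 b.+1)%:E); last first.
    rewrite EFin_beta_fun [LHS]integral_mkcond; apply: eq_integral => x _.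
    rewrite !patchE !mem_setE !in_itv/= andbT /XMonemX /pos_pow.
    have [x0|x0] := leP 0 x => //=.
    rewrite subr_ge0 ger0_norm//; case: ifPn => //=; by rewrite mulr0.
  rewrite beta_fun_fact /pos_pow ltW// -!EFinM; congr EFin.
  by rewrite exprS natrM; ring.
(* At [s = 0] the integrand vanishes off the origin but may be 1 there, so it is compared with an
   integral over the null set [{0}]. *)
- rewrite /pos_pow lexx expr0n/= mulr0 -[RHS](integral_set1 (fun x : R =>
    (`|x| ^+ a * pos_pow b (0 - `|x|))%:E) 0) [RHS]integral_mkcond.
  apply: eq_integral => x _; rewrite patchE.
  have [->|x0] := eqVneq x 0; first by rewrite mem_set.
  rewrite memNset/=; last exact/eqP.
  by rewrite [0 <= _]lt_geF ?mulr0// sub0r oppr_lt0 normr_gt0.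
Qed.

End one_dimensional_integrals.

(** * Moments of the bipyramid *)

Section bipyramid.
Context {R : realType}.
Local Notation T n := (n.-tuple (measurableTypeR R)).
Local Notation mu n := (@lebesgue_tuple R n).

(** The monomial [|t|^a] times the indicator of the bipyramid of size [s] whose
    first [m] coordinates are the needles, unfolded one coordinate at a time
    for Fubini; [bipyr_weightE] gives the closed form. *)
Fixpoint bipyr_weight n (m : nat) (a : nat -> nat) (s : R) : T n -> R :=
  match n with
  | 0 => fun=> pos_pow 0 s
  | n'.+1 => fun t => `|thead t| ^+ a 0 *
     if m is m'.+1 then bipyr_weight m' (a \o S) (s - `|thead t|)
       [tuple of behead t]
     else pos_pow 0 (s - `|thead t|) * bipyr_weight 0 (a \o S) s
       [tuple of behead t]
  end.

(** One Beta integral per coordinate. For a needle, [b] is the degree of homogeneity in [s] of the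
    integral over the remaining coordinates; any other coordinate is independent of the later ones,
    hence [b = 0] and a factor [2 / (a 0 + 1)]. *)
Fixpoint bipyr_coef n (m : nat) (a : nat -> nat) : R :=
  match n with
  | 0 => 1
  | n'.+1 => let b := if m is 0 then 0 else (n' + \sum_(i < n') a i.+1)%N in
     2 * (a 0)`!%:R * b`!%:R / (a 0 + b).+1`!%:R * bipyr_coef n' m.-1 (a \o S)
  end.

Lemma bipyr_weight_ge0 n m a s (t : T n) : 0 <= bipyr_weight m a s t.
Proof.
elim: n m a s t => [|n IH] m a s t /=; first exact: pos_pow_ge0.
by rewrite mulr_ge0 ?exprn_ge0//; case: m => [|m] //;
  rewrite mulr_ge0 ?pos_pow_ge0.
Qed.

Lemma measurable_bipyr_weight n m a :
  measurable_fun [set: measurableTypeR R * T n]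
    (fun st : measurableTypeR R * T n => bipyr_weight m a st.1 st.2).
Proof.
elim: n m a => [|n IH] m a /=; first exact: measurableT_comp
  (measurable_pos_pow 0) _.
have mh : measurable_fun [set: measurableTypeR R * T n.+1]
  (fun st : measurableTypeR R * T n.+1 => `|thead st.2|).
  apply: (measurableT_comp (@normr_measurable R setT)).
  by apply: (measurableT_comp (@measurable_tnth _ (measurableTypeR R) n.+1
    ord0)).
have mb : measurable_fun [set: measurableTypeR R * T n.+1]
  (fun st : measurableTypeR R * T n.+1 => [tuple of behead st.2] : T n).
  by apply: (measurableT_comp (@measurable_behead _ (measurableTypeR R) n)).
have md : measurable_fun [set: measurableTypeR R * T n.+1]
  (fun st : measurableTypeR R * T n.+1 => st.1 - `|thead st.2|).
  exact: measurable_funB.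
apply: measurable_funM; first exact: measurable_funX.
case: m => [|m].
  apply: measurable_funM; first exact: measurableT_comp (measurable_pos_pow 0)
    _.
  apply: (measurableT_comp (IH 0 (a \o S))
    (g := fun st : measurableTypeR R * T n.+1 =>
    (st.1, [tuple of behead st.2] : T n))).
  exact: measurable_fun_pair.
apply: (measurableT_comp (IH m (a \o S)) (g := fun st : measurableTypeR R * T
  n.+1 => (st.1 - `|thead st.2|, [tuple of behead st.2] : T n))).
exact: measurable_fun_pair.
Qed.

Lemma bipyr_coef_gt0 n m a : 0 < bipyr_coef n m a.
Proof.
elim: n m a => [|n IH] m a //=.
by rewrite mulr_gt0// divr_gt0// ?mulr_gt0// ltr0n fact_gt0.
Qed.

(** Induction over all sizes [s]: integrating out the later coordinates leaves a multiple of a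
    truncated power of [s - |x|] if the first coordinate [x] is a needle, and of [s] otherwise. *)
Lemma integral_bipyr_weight n m a s :
  (\int[mu n]_t (bipyr_weight m a s t)%:E =
   (bipyr_coef n m a * pos_pow (n + \sum_(i < n) a i) s)%:E)%E.
Proof.
elim: n m a s => [|n IH] m a s.
  rewrite integral_lebesgue_tuple0; last by move=> t;
    rewrite lee_fin bipyr_weight_ge0.
  by rewrite big_ord0 mul1r.
rewrite integral_lebesgue_tupleS; last 2 first.
- apply/measurable_EFinP.
  apply: (measurableT_comp (@measurable_bipyr_weight n.+1 m a)
    (g := fun t => (s, t))).
  exact: measurable_fun_pair.
- by move=> t; rewrite lee_fin bipyr_weight_ge0.
have tC x (v : T n) : thead (tuple_cons (x, v)) = x by [].
have bC x (v : T n) : [tuple of behead (tuple_cons (x, v))] =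
  v by exact/val_inj.
have mw m' r : measurable_fun [set: T n] (fun v =>
  (bipyr_weight m' (a \o S) r v)%:E).
  apply/measurable_EFinP.
  apply: (measurableT_comp (@measurable_bipyr_weight n m' (a \o S))
    (g := fun t => (r, t))).
  exact: measurable_fun_pair.
have wge m' r (v : T n) : (0 <= (bipyr_weight m' (a \o S) r v)%:E)%E.
  by rewrite lee_fin bipyr_weight_ge0.
under eq_integral => x _.
  under eq_integral => v _ do rewrite /bipyr_weight -/bipyr_weight tC bC.
  over.
case: m => [|m].
- under eq_integral => x _.
    under eq_integral do rewrite mulrA EFinM.
    rewrite ge0_integralZl//; last by rewrite lee_fin mulr_ge0 ?exprn_ge0
      ?pos_pow_ge0.
    rewrite IH.
    over.
  rewrite ge0_integralZr//; last 3 first.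
  - by apply/measurable_EFinP; exact: measurable_abs_pow.
  - by move=> x _; rewrite lee_fin mulr_ge0 ?exprn_ge0 ?pos_pow_ge0.
  - by rewrite -IH; apply: integral_ge0 => v _; exact: wge.
  rewrite integral_abs_pow -EFinM (_ : \sum_(i < n.+1) a i =
    a 0 + \sum_(i < n) (a \o S) i)%N; last by rewrite big_ord_recl.
  rewrite mulrACA -pos_powD.
  by rewrite /= !addn0 !addSn addnCA.
- under eq_integral => x _.
    under eq_integral do rewrite EFinM.
    rewrite ge0_integralZl//.
    rewrite IH -EFinM mulrCA EFinM.
    over.
  rewrite ge0_integralZl//; last 3 first.
  - by apply/measurable_EFinP; exact: measurable_abs_pow.
  - by move=> x _; rewrite lee_fin mulr_ge0 ?exprn_ge0 ?pos_pow_ge0.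
  - by rewrite lee_fin ltW ?bipyr_coef_gt0.
  rewrite integral_abs_pow -EFinM (_ : \sum_(i < n.+1) a i =
    a 0 + \sum_(i < n) (a \o S) i)%N; last by rewrite big_ord_recl.
  rewrite mulrA [_ * (_ / _)]mulrC.
  by rewrite /= !addSn addnCA.
Qed.

End bipyramid.

Section bipyramid_moments.
Context {R : realType}.
Local Notation T n := (n.-tuple (measurableTypeR R)).

(** The first conjunct only matters when there is no coordinate at all. *)
Definition bipyr n m (s : R) (t : T n) : bool :=
  (\sum_(i < n) (i < m)%N%:R * `|tnth t i| <= s) &&
  [forall l : 'I_n, \sum_(i < n) ((i < m)%N || (i == l))%:R * `|tnth t i| <= s].

Lemma forall_ordS n (P : pred 'I_n.+1) :
  [forall l, P l] = P ord0 && [forall l : 'I_n, P (lift ord0 l)].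
Proof.
apply/forallP/andP => [h|[h0 /forallP h] l]; first by split=> //; apply/forallP.
by have [j ->|->] := unliftP ord0 l.
Qed.

Lemma bipyr_weightE n m a s (t : T n) :
  bipyr_weight m a s t = (bipyr m s t)%:R * \prod_(i < n) `|tnth t i| ^+ a i.
Proof.
have pp0 (r : R) : pos_pow 0 r = (0 <= r)%R%:R by rewrite /pos_pow expr0;
  case: ifP.
elim: n m a s t => [|n IH] m a s t.
  rewrite /= /bipyr !big_ord0 mulr1 pp0.
  by rewrite (_ : [forall l, _] = true) ?andbT//; apply/forallP => -[].
have [x [v ->]] : exists x v, t = tuple_cons (x, v).
  by exists (thead t), [tuple of behead t]; rewrite {1}(tuple_eta t).
rewrite /= (_ : thead (tuple_cons (x, v)) = x)// (_ : [tuple of _] = v);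
  last exact/val_inj.
rewrite big_ord_recl /= (_ : tnth (tuple_cons (x, v)) ord0 = x)//.
under eq_bigr do rewrite /tuple_cons tnthS.
rewrite mulrCA; congr (_ * _).
case: m => [|m]; rewrite IH ?pp0 ?mulrA -?natrM ?mulnb;
  congr ((nat_of_bool _)%:R * _).
- rewrite /bipyr forall_ordS !big_ord_recl/= !mul0r !add0r mul1r.
  have z (F : 'I_n -> R) : \sum_(i < n) 0 * F i = 0.
    by apply: big1 => i _; rewrite mul0r.
  rewrite !z subr_ge0 (_ : tnth (tuple_cons (x, v)) ord0 = x)//.
  rewrite addr0 andbCA; congr [&& _, _ & _].
  apply: eq_forallb => l; rewrite big_ord_recl/= mul0r add0r.
  by under [in RHS]eq_bigr do rewrite /tuple_cons tnthS (inj_eq lift_inj).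
- have E : \sum_(i < n.+1) (i < m.+1)%N%:R * `|tnth (tuple_cons (x, v)) i| =
     `|x| + \sum_(i < n) (i < m)%N%:R * `|tnth v i|.
    by rewrite big_ord_recl mul1r; under eq_bigr do rewrite /tuple_cons tnthS.
  rewrite /bipyr forall_ordS/= !E.
  (* The constraint indexed by a needle only repeats the one on the sum of the needles. *)
  rewrite (_ : \sum_(i < n.+1) ((i < m.+1)%N || (i == ord0))%:R *_ =
     `|x| + \sum_(i < n) (i < m)%N%:R * `|tnth v i|); last first.
    rewrite -E; apply: eq_bigr => i _; congr (_%:R * _).
    by case: eqP => [->|]; rewrite ?orbF.
  rewrite andbA andbb lerBrDl; congr (_ && _).
  apply: eq_forallb => l; rewrite big_ord_recl/= mul1r lerBrDl.
  by under [in RHS]eq_bigr do rewrite /tuple_cons tnthS (inj_eq lift_inj).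
Qed.

Definition incr_exp (a : nat -> nat) (j i : nat) : nat := (a i + (i == j))%N.

(** The Dirichlet recursion. Factor [j] gains [a j + 1] above and a new term below; in each earlier
    factor [b] grows by one. The resulting quotients telescope, and only the total degree plus one
    survives below. *)
Lemma bipyr_coef_inc n m a j : (j < m)%N -> (j < n)%N ->
  bipyr_coef n m (incr_exp a j) =
  (a j).+1%:R / (n + \sum_(i < n) a i).+1%:R * bipyr_coef n m a :> R.
Proof.
move=> jm jn.
have fn k : k`!%:R != 0 :> R by rewrite pnatr_eq0 -lt0n fact_gt0.
elim: n m a j jm jn => // n IH [//|m] a [|j] jm jn /=.
- rewrite (_ : incr_exp a 0 \o S = a \o S); last first.
    by apply/funext => i; rewrite /incr_exp /= addn0.
  under eq_bigr do rewrite /incr_exp /= addn0.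
  rewrite /incr_exp eqxx addn1 big_ord_recl/=.
  under [X in (n.+1 + (_ + X))%N]eq_bigr do rewrite /bump/= add1n.
  set b := (n + _)%N; set c := bipyr_coef _ _ _.
  rewrite (_ : (n.+1 + _).+1 = (a 0 + b).+2)%N; last by rewrite /b; lia.
  rewrite addSn !factS !natrM.
  have := fn (a 0 + b)%N; have := fn b.
  by move=> F1 F2; field; rewrite F2 -[1]/(1%:R) -!natrD !pnatr_eq0.
- rewrite (_ : incr_exp a j.+1 \o S = incr_exp (a \o S) j)//.
  rewrite IH//.
  rewrite (_ : \sum_(i < n) incr_exp a j.+1 i.+1 = (\sum_(i < n) a i.+1).+1)%N;
    last first.
    rewrite /incr_exp big_split/= -[RHS]addn1; congr (_ + _)%N.
    rewrite (bigD1 (Ordinal (jn : (j < n)%N)))//= eqxx big1 ?addn0// => i.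
    by rewrite -val_eqE/= eqSS => /negbTE ->.
  rewrite /incr_exp /= addn0 big_ord_recl/=.
  under [X in (n.+1 + (_ + X))%N]eq_bigr do rewrite /bump/= add1n.
  rewrite addnS; set b := (n + _)%N; set c := bipyr_coef _ _ _.
  rewrite (_ : (n.+1 + _).+1 = (a 0 + b).+2)%N; last by rewrite /b; lia.
  rewrite addnS !factS !natrM.
  by field; rewrite fn -[1]/(1%:R) -!natrD !pnatr_eq0.
Qed.

Lemma sum_double_eq n l : (l < n)%N -> (\sum_(i < n) (val i == l).*2 = 2)%N.
Proof.
move=> ln; rewrite (bigD1 (Ordinal ln))//= eqxx big1 ?addn0// => i.
by rewrite -val_eqE/= => /negbTE ->.
Qed.

(** The factor of coordinate [l] drops from 2 to 2/3, and each needle factor [2 / (b + 1)] becomes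
    [2 / (b + 3)]; the quotients [(b + 1) / (b + 3)] telescope over the [m] needles. *)
Lemma bipyr_coef_sq n m l : (m <= l)%N -> (l < n)%N ->
  bipyr_coef n m (fun i => (i == l).*2) * (3 * n.+1 * n.+2)%:R =
  bipyr_coef n m (fun=> 0%N) * ((n - m).+1 * (n - m).+2)%:R :> R.
Proof.
have fn k : k`!%:R != 0 :> R by rewrite pnatr_eq0 -lt0n fact_gt0.
elim: n m l => // n IH [|m] [|l] ml ln //=.
- rewrite (_ : _ \o _ = (fun=> 0)%N)// [in RHS](_ : _ \o _ = (fun=> 0)%N)//
    addn0 subn0.
  by rewrite (_ : 3`! = 6)%N// (_ : 2`! = 2)%N// !natrM; field.
- rewrite [in RHS](_ : _ \o _ = (fun=> 0)%N)// addn0 subn0.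
  rewrite (_ : _ \o _ = fun i => (i == l).*2)//.
  have := IH 0 l isT ln; rewrite subn0 -mulnA natrM mulrA.
  move=> /mulIf; rewrite pnatr_eq0 => /(_ isT) E.
  by rewrite -mulnA natrM -E; ring.
- rewrite [in RHS](_ : _ \o _ = (fun=> 0)%N)// subSS.
  rewrite (_ : _ \o _ = fun i => (i == l).*2)//.
  have := IH m l ml ln.
  under eq_bigr do rewrite eqSS.
  rewrite sum_double_eq// big1// addn0 !add0n addn2.
  set c := bipyr_coef _ _ _; set c0 := bipyr_coef _ _ _ => E.
  rewrite !factS !natrM.
  have -> : forall x : R, 2 * 1 * n`!%:R / (n.+1%:R * n`!%:R) * c0 * x =
    2 / n.+1%:R * (c0 * x).
    by move=> x; field; rewrite fn -[1]/(1%:R) -!natrD !pnatr_eq0.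
  rewrite -[X in _ = _ * (c0 * X)]natrM -E !natrM (_ : 0.*2 = 0)%N// fact0.
  by field; rewrite fn -[1]/(1%:R) -!natrD !pnatr_eq0.
Qed.

End bipyramid_moments.

(** * Stability of the moments under the cut *)

Section bipyramid_cut.
Context {R : realType}.
Local Notation T n := (n.-tuple (measurableTypeR R)).
Local Notation mu n := (@lebesgue_tuple R n).

Definition abs_monomial n (a : nat -> nat) (t : T n) : R :=
  \prod_(i < n) `|tnth t i| ^+ a i.

Lemma abs_monomial_ge0 n a (t : T n) : 0 <= abs_monomial a t.
Proof. by apply: prodr_ge0 => i _; exact: exprn_ge0. Qed.

Lemma measurable_abs_monomial n a : measurable_fun [set: T n]
    (@abs_monomial n a).
Proof.
apply: measurable_prod => i _; apply: measurable_funX.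
apply: (measurableT_comp (@normr_measurable R setT)).
exact: (@measurable_tnth _ (measurableTypeR R) n i).
Qed.

Lemma abs_monomial_inc n a (t : T n) (j : 'I_n) :
  abs_monomial (incr_exp a j) t = abs_monomial a t * `|tnth t j|.
Proof.
rewrite /abs_monomial (bigD1 j)//= [in RHS](bigD1 j)//=
  /incr_exp eqxx addn1 exprSr.
rewrite -!mulrA; congr (_ * _); rewrite mulrC; congr (_ * _).
by apply: eq_bigr => i; rewrite -val_eqE => /negbTE ->; rewrite addn0.
Qed.

Lemma measurable_wsum n (w : 'I_n -> R) :
  measurable_fun [set: T n] (fun t : T n => \sum_(i < n) w i * `|tnth t i|).
Proof.
apply: measurable_sum => i; apply: measurable_funM => //.
apply: (measurableT_comp (@normr_measurable R setT)).
exact: (@measurable_tnth _ (measurableTypeR R) n i).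
Qed.

Lemma integral_bipyr n m a :
  (\int[mu n]_t ((bipyr m 1 t)%:R * abs_monomial a t)%:E =
    (bipyr_coef n m a)%:E)%E.
Proof.
under eq_integral do rewrite -bipyr_weightE.
by rewrite integral_bipyr_weight /pos_pow ler01 expr1n mulr1.
Qed.

Lemma measurable_bipyrM n m a :
  measurable_fun [set: T n] (fun t : T n =>
    ((bipyr m 1 t)%:R * abs_monomial a t : R)).
Proof.
rewrite (_ : (fun t => _) = fun t => bipyr_weight m a 1 t).
  apply: (measurableT_comp (@measurable_bipyr_weight R n m a)
    (g := fun t : T n => (1 : measurableTypeR R, t))).
  exact: measurable_fun_pair.
by apply/funext => t; rewrite bipyr_weightE.
Qed.

(** Markov's inequality: [sum w_i |t_i| > 1] on the part that is cut off. *)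
Lemma integral_bipyr_cut n m (w : 'I_n -> R) (a : nat -> nat) :
  (forall i, 0 <= w i) -> (forall i : 'I_n, (m <= i)%N -> w i = 0) ->
  (forall i : 'I_n, (i < m)%N -> (a i <= 2)%N) ->
  let delta := 3 / n%:R * \sum_(i < n) w i in
  exists2 M : R,
    (\int[mu n]_t ((bipyr m 1 t && (\sum_(i < n) w i * `|tnth t i| <= 1)%R)%:R *
      abs_monomial a t)%:E = M%:E)%E &
    (1 - delta) * bipyr_coef n m a <= M <= bipyr_coef n m a.
Proof.
move=> w0 wm am delta.
pose H (t : T n) := bipyr m 1 t && (\sum_(i < n) w i * `|tnth t i| <= 1)%R.
have mH : measurable_fun [set: T n] (fun t : T n =>
  (H t)%:R * abs_monomial a t : R).
  rewrite (_ : (fun t => _) = fun t => if \sum_(i < n) w i * `|tnth t i| <=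
    1 then (bipyr m 1 t)%:R * abs_monomial a t else 0); last first.
    by apply/funext => t; rewrite /H andbC; case: ifP => //=; rewrite mul0r.
  apply: measurable_fun_ifT => //; last exact: measurable_bipyrM.
  apply: measurable_fun_ler => //; exact: measurable_wsum.
have H0 (t : T n) : (0 <= ((H t)%:R * abs_monomial a t)%:E)%E.
  by rewrite lee_fin mulr_ge0 ?abs_monomial_ge0.
pose I := (\int[mu n]_t ((H t)%:R * abs_monomial a t)%:E)%E.
suff: exists2 M, I = M%:E & (1 - delta) * bipyr_coef n m a <= M <=
  bipyr_coef n m a by [].
have I0 : (0 <= I)%E by apply: integral_ge0 => t _; exact: H0.
have Iu : (I <= (bipyr_coef n m a)%:E)%E.
  rewrite -integral_bipyr; apply: ge0_le_integral => //.
  - exact/measurable_EFinP.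
  - by apply/measurable_EFinP; exact: measurable_bipyrM.
  - move=> t _; rewrite lee_fin ler_wpM2r ?abs_monomial_ge0// ler_nat /H.
    by case: (bipyr _ _ _) => //=; exact: leq_b1.
have Il : ((bipyr_coef n m a)%:E <= I + (delta * bipyr_coef n m a)%:E)%E.
  rewrite -integral_bipyr.
  apply: (@le_trans _ _ (\int[mu n]_t (((H t)%:R * abs_monomial a t)%:E +
     \sum_(j < n) (w j * ((bipyr m 1 t)%:R * abs_monomial (incr_exp a j)
       t))%:E))%E).
    apply: ge0_le_integral => //.
    - by move=> t _; rewrite lee_fin mulr_ge0 ?abs_monomial_ge0.
    - by apply/measurable_EFinP; exact: measurable_bipyrM.
    - apply: emeasurable_funD; first exact/measurable_EFinP.
      apply: emeasurable_sum => j; apply/measurable_EFinP.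
      by apply: measurable_funM => //; exact: measurable_bipyrM.
    - move=> t _; rewrite sumEFin -EFinD lee_fin.
      rewrite (_ : \sum_(j < n) _ = (bipyr m 1 t)%:R * abs_monomial a t *
        \sum_(i < n) w i * `|tnth t i|); last first.
        rewrite mulr_sumr; apply: eq_bigr => j _; rewrite abs_monomial_inc;
          ring.
      rewrite /H; case: (bipyr m 1 t); rewrite ?mul0r ?addr0//= mul1r.
      case: (leP _ 1) => s1; rewrite ?mul1r ?mul0r ?add0r.
        by rewrite lerDl mulr_ge0 ?abs_monomial_ge0// sumr_ge0// => i _;
          rewrite mulr_ge0.
      by rewrite ler_peMr ?abs_monomial_ge0// ltW.
  rewrite ge0_integralD//; last 3 first.
  - exact/measurable_EFinP.
  - move=> t _; apply: sume_ge0 => j _.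
    by rewrite lee_fin mulr_ge0 ?mulr_ge0 ?abs_monomial_ge0.
  - apply: emeasurable_sum => j; apply/measurable_EFinP.
    by apply: measurable_funM => //; exact: measurable_bipyrM.
  rewrite leeD2lE; last by rewrite ge0_fin_numE// (le_lt_trans Iu)// ltry.
  rewrite ge0_integral_sum//; last 2 first.
  - move=> j; apply/measurable_EFinP.
    by apply: measurable_funM => //; exact: measurable_bipyrM.
  - by move=> j t _; rewrite lee_fin mulr_ge0 ?mulr_ge0 ?abs_monomial_ge0.
  rewrite (_ : (delta * _)%:E = \sum_(j < n)
    (3 / n%:R * w j * bipyr_coef n m a)%:E)%E; last first.
    by rewrite sumEFin -mulr_suml -mulr_sumr.
  apply: lee_sum => j _.
  under eq_integral do rewrite EFinM.
  rewrite ge0_integralZl//; last 3 first.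
  - by apply/measurable_EFinP; exact: measurable_bipyrM.
  - by move=> t _; rewrite lee_fin mulr_ge0 ?abs_monomial_ge0.
  - by rewrite lee_fin.
  rewrite integral_bipyr -EFinM lee_fin.
  (* Origin of the 3 in [delta]: by [bipyr_coef_inc] an extra factor [|t_j|] costs
     [(a j + 1) / (n + sum a + 1)], at most [3 / n] since [a j <= 2]. *)
  have [mj|jm] := leqP m j; first by rewrite wm// mul0r mulr0 mul0r.
  rewrite bipyr_coef_inc// mulrA; apply: ler_wpM2r.
    by rewrite ltW// bipyr_coef_gt0.
  rewrite mulrC ler_wpM2r//.
  rewrite ler_pdivrMr ?ltr0n// mulrAC ler_pdivlMr ?ltr0n
    ?(leq_ltn_trans _ (ltn_ord j))//.
  by rewrite -!natrM ler_nat leq_mul// ?ltnS ?am// ltnW// ltnS leq_addr.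
move: I0 Iu Il; clearbody I; case: I => [r _|_|];
  [|by rewrite leye_eq|by rewrite leeNy_eq].
rewrite -EFinD !lee_fin => Iu Il; exists r => //; rewrite Iu andbT.
by rewrite mulrBl mul1r lerBlDr.
Qed.

End bipyramid_cut.

(** * Isotropic unconditional polytopes *)

Section polytope_integrals.
Context {R : realType} (d : nat) (I : finType).
Local Notation T := (d.-tuple (measurableTypeR R)).
Local Notation mu := (@lebesgue_tuple R d).
Implicit Types (A : I -> 'I_d -> R) (c : 'I_d -> R).

Definition polytope A : set 'rV[R]_d :=
  [set x | forall r, \sum_(i < d) A r i * `|x ord0 i| <= 1].

Definition in_poly A (t : T) : bool :=
  [forall r, \sum_(i < d) A r i * `|tnth t i| <= 1].

(** The rows of the image of the polytope under the diagonal map with positive entries [c i]. *)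
Definition scale_rows A c : I -> 'I_d -> R := fun r i => A r i / c i.

Lemma row_of_tuple_polytope A :
  (@row_of_tuple R d) @^-1` polytope A = [set t | in_poly A t].
Proof.
apply/seteqP; split => t /=.
  by move=> h; apply/forallP => r; have := h r; under eq_bigr do rewrite mxE.
by move=> /forallP h r; have := h r; under [in X in _ -> X]eq_bigr do rewrite
  mxE.
Qed.

Lemma measurable_in_poly A : measurable [set t : T | in_poly A t].
Proof.
rewrite (_ : [set t | _] = \big[setI/setT]_r
  [set t : T | \sum_(i < d) A r i * `|tnth t i| <= 1]).
  apply: bigsetI_measurable => r _.
  rewrite (_ : [set t | _] = (fun t : T => \sum_(i < d) A r i * `|tnth t i|)
    @^-1` `]-oo, 1%R]%classic).
    by rewrite -[X in measurable X]setTI; exact: measurable_wsum.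
  by apply/seteqP; split => t /=; rewrite in_itv.
apply/seteqP; split => t; rewrite -bigcap_seq/=.
  by move=> /forallP At r _ /=.
by move=> At; apply/forallP => r; apply: At; rewrite /= mem_index_enum.
Qed.

Lemma in_poly_scale A c t : (forall i, 0 < c i) ->
  in_poly (scale_rows A c) (scale_tuple c t) = in_poly A t.
Proof.
move=> c0; apply: eq_forallb => r; congr (_ <= _); apply: eq_bigr => i _.
by rewrite tnth_mktuple normrM gtr0_norm// /scale_rows mulrA divfK// gt_eqF.
Qed.

Lemma integral_in_poly A (g : T -> R) :
  (\int[mu]_(t in [set t | in_poly A t]) (g t)%:E =
   \int[mu]_t ((in_poly A t)%:R * g t)%:E)%E.
Proof.
rewrite integral_mkcond; apply: eq_integral => t _; rewrite patchE.
case: ifPn => [/set_mem/= ->|/negP]; first by rewrite mul1r.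
by move=> h; rewrite (_ : in_poly _ _ = false) ?mul0r//; apply/negP => /mem_set.
Qed.

Lemma measurable_in_polyM A (g : T -> R) : measurable_fun [set: T] g ->
  measurable_fun [set: T] (fun t => ((in_poly A t)%:R * g t)%:E).
Proof.
move=> mg; rewrite (_ : (fun t => _) =
    EFin \o (fun t => \1_[set t | in_poly A t] t * g t)); last first.
  apply/funext => t /=; rewrite indicE; congr (_%:R * _)%:E; congr nat_of_bool.
  by apply/idP/idP => [/mem_set|/set_mem].
apply/measurable_EFinP; apply: measurable_funM => //.
by apply: measurable_indic; exact: measurable_in_poly.
Qed.

Lemma integral_scale_rows A c (g : T -> R) : (forall i, 0 < c i) ->
  measurable_fun [set: T] g -> (forall t, 0 <= g t) ->
  (\int[mu]_(t in [set t | in_poly (scale_rows A c) t]) (g t)%:E =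
   (\prod_i c i)%:E * \int[mu]_t ((in_poly A t)%:R * g (scale_tuple c t))%:E)%E.
Proof.
move=> c0 mg g0.
pose F (t : T) := (((in_poly (scale_rows A c) t)%:R * g t)%:E)%E.
rewrite integral_in_poly.
have mF : measurable_fun [set: T] F by exact: measurable_in_polyM.
have F0 t : (0 <= F t)%E by rewrite lee_fin mulr_ge0.
have := @ge0_integral_scale_tuple R d c F (fun i => lt0r_neq0 (c0 i)) mF F0.
under eq_integral do rewrite /F in_poly_scale//.
move=> ->; rewrite muleA -EFinM -big_split/= big1 ?mul1e// => i _.
by rewrite gtr0_norm// mulfV// gt_eqF.
Qed.

Lemma integral_flip_poly A (e : 'I_d -> R) (g : T -> R) :
  (forall i, `|e i| = 1) -> measurable_fun [set: T] g -> (forall t, 0 <= g t) ->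
  (\int[mu]_(t in [set t | in_poly A t]) (g (scale_tuple e t))%:E =
   \int[mu]_(t in [set t | in_poly A t]) (g t)%:E)%E.
Proof.
move=> e1 mg g0; rewrite !(integral_in_poly A).
have e0 i : e i != 0 by rewrite -normr_gt0 e1.
have flip t : in_poly A (scale_tuple e t) = in_poly A t.
  apply: eq_forallb => r; congr (_ <= _); apply: eq_bigr => i _.
  by rewrite tnth_mktuple normrM e1 mul1r.
have := @ge0_integral_scale_tuple R d e _ e0 (measurable_in_polyM A mg).
under eq_integral do rewrite flip.
move=> ->; first by rewrite big1 ?mul1e// => i _; rewrite e1 invr1.
by move=> t; rewrite lee_fin mulr_ge0.
Qed.

Definition square_exp (i : 'I_d) : nat -> nat := fun j => (j == i).*2.

Lemma abs_monomial_square_exp i (t : T) :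
  abs_monomial (square_exp i) t = tnth t i ^+ 2.
Proof.
rewrite /abs_monomial (bigD1 i)//= /square_exp eqxx -[true.*2]/2%N big1 ?mulr1
  ?real_normK ?num_real// => j.
by rewrite -val_eqE => /negbTE /= ->.
Qed.

(** [V] and [M i] are the volume and second moments before the diagonal map [c], which multiplies
    all integrals by the product of the [c i] and the [i]-th second moment by a further [c i ^+ 2].
    Mixed moments vanish by symmetry. *)
Lemma isotropic_polytope A c (V L : R) (M : 'I_d -> R) :
  (forall i, 0 < c i) -> 0 < V -> 0 < L ->
  (\int[mu]_t ((in_poly A t)%:R * abs_monomial (fun=> 0%N) t)%:E = V%:E)%E ->
  (forall i, \int[mu]_t ((in_poly A t)%:R * abs_monomial (square_exp i) t)%:E =
    (M i)%:E)%E ->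
  (forall i, c i ^+ 2 * M i = L ^+ 2 * V) ->
  isotropic (polytope (scale_rows A c)).
Proof.
move=> c0 V0 L0 hV hM hL; exists L => // i j.
pose P := \prod_i c i.
have P0 : 0 < P by exact: prodr_gt0.
have volE : volume (polytope (scale_rows A c)) = (P * V)%:E.
  rewrite /volume row_of_tuple_polytope -[LHS]mul1e -integral_cst//;
    last exact: measurable_in_poly.
  rewrite (integral_scale_rows _ (g := fun=> 1))// EFinM -hV.
  by congr (_ * _)%E; apply: eq_integral => t _; rewrite /abs_monomial big1.
have sqE k : (\int[mu]_(t in [set t | in_poly (scale_rows A c) t])
  (tnth t k ^+ 2)%:E = (P * (c k ^+ 2 * M k))%:E)%E.
  rewrite (integral_scale_rows _ (g := fun t : T => tnth t k ^+ 2))//;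
    last 2 first.
  - by apply: measurable_funX; exact: (@measurable_tnth _ (measurableTypeR R) d
      k).
  - by move=> t; exact: sqr_ge0.
  rewrite EFinM; congr (_ * _)%E; rewrite EFinM -hM.
  rewrite -ge0_integralZl_EFin ?sqr_ge0//; last 2 first.
  - by move=> t _; rewrite lee_fin mulr_ge0// abs_monomial_ge0.
  - by apply: measurable_in_polyM; exact: measurable_abs_monomial.
  apply: eq_integral => t _; rewrite -EFinM; congr EFin.
  by rewrite tnth_mktuple abs_monomial_square_exp; ring.
rewrite volE row_of_tuple_polytope /=.
have [<-|ij] := eqVneq i j.
  under eq_integral do rewrite -expr2.
  rewrite sqE hL -EFinM mul1r; congr EFin; field.
  by rewrite !gt_eqF.
rewrite mul0r.
set G := [set t | _] in sqE *.
suff -> : (\int[mu]_(x in G) (tnth x i * tnth x j)%:E = 0)%E by rewrite mule0.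
have mG : measurable G := measurable_in_poly _.
have mt k : measurable_fun [set: T] (fun t : T => tnth t k : R).
  exact: (@measurable_tnth _ (measurableTypeR R) d k).
(* For [s = 1] and [s = -1] these are the positive and negative parts of [t_i * t_j]. *)
pose f (s : R) (t : T) := Num.max (s * (tnth t i * tnth t j)) 0.
have mf s : measurable_fun [set: T] (f s).
  by apply: measurable_maxr => //; apply: measurable_funM => //;
    exact: measurable_funM.
have f0 s t : 0 <= f s t by rewrite /f le_max lexx orbT.
pose J s := (\int[mu]_(t in G) (f s t)%:E)%E.
have J0 s : (0 <= J s)%E by apply: integral_ge0 => t _; rewrite lee_fin.
have JE : (\int[mu]_(x in G) (tnth x i * tnth x j)%:E = J 1%R - J (-1)%R)%E.
  rewrite integralE /J; congr (_ - _)%E; apply: eq_integral => t _.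
    by rewrite funeposE /f mul1r EFin_max.
  by rewrite funenegE /f mulN1r EFin_max.
(* Finiteness, from [t_i * t_j <= t_i^2 + t_j^2], is what makes the difference of the two equal
   parts 0. *)
have Jfin : J 1 \is a fin_num.
  rewrite ge0_fin_numE//; apply: (@le_lt_trans _ _
    (P * (c i ^+ 2 * M i) + P * (c j ^+ 2 * M j))%:E); last exact: ltry.
  rewrite EFinD -!sqE -ge0_integralD//; last 4 first.
  - by move=> t _; rewrite lee_fin sqr_ge0.
  - by apply: measurable_funTS; apply/measurable_EFinP; exact: measurable_funX.
  - by move=> t _; rewrite lee_fin sqr_ge0.
  - by apply: measurable_funTS; apply/measurable_EFinP; exact: measurable_funX.
  apply: ge0_le_integral => //.
  - by move=> t _; rewrite lee_fin.
  - by apply: measurable_funTS; apply/measurable_EFinP; exact: mf.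
  - apply: measurable_funTS; apply/measurable_EFinP; apply: measurable_funD;
      exact: measurable_funX.
  - move=> t _; rewrite -EFinD lee_fin /f mul1r ge_max addr_ge0 ?sqr_ge0//
      andbT.
    by have := sqr_ge0 (tnth t i - tnth t j);
      have := sqr_ge0 (tnth t i + tnth t j); nra.
(* Changing the sign of [t_i] exchanges the two parts of [t_i * t_j]. *)
suff JJ : J (-1) = J 1 by rewrite JE JJ subee.
pose e k : R := if k == i then -1 else 1.
rewrite /J /G -[RHS](@integral_flip_poly _ e)//; last by move=> k; rewrite /e;
  case: ifP; rewrite ?normrN normr1.
apply: eq_integral => t _; congr EFin.
by rewrite /f !tnth_mktuple /e eqxx eq_sym (negbTE ij); congr Num.max; ring.
Qed.

End polytope_integrals.

(** * Convexity, topology and symmetry of the polytopes *)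

Section polytope_body.
Context {R : realType} (d : nat) (I : finType).
Implicit Types (A : I -> 'I_d -> R).

Lemma continuous_wsum (w : 'I_d -> R) :
  continuous (fun x : 'rV[R]_d => \sum_(i < d) w i * `|x ord0 i|).
Proof.
apply: (@continuous_big R 'I_d +%R 0 xpredT _ _ _
  (fun i (x : 'rV[R]_d) => w i * `|x ord0 i|)) => [|i _].
  exact: (@add_continuous R).
move=> x; apply: (@continuousM R 'rV[R]_d (fun=> w i)
  (fun M : 'rV[R]_d => `|M ord0 i|) x); first exact: cst_continuous.
apply: (@continuous_comp _ _ _ (fun M : 'rV[R]_d => M ord0 i) (@Num.norm R R)).
  exact: coord_continuous.
exact: norm_continuous.
Qed.

Lemma convex_body_polytope A :
  (forall r i, 0 <= A r i) -> (forall i, exists r, 0 < A r i) ->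
  convex_body (polytope A).
Proof.
move=> A0 Ap; split.
- rewrite (_ : polytope A = \bigcap_(r in setT)
    ((fun x : 'rV[R]_d => \sum_(i < d) A r i * `|x ord0 i|) @^-1`
      [set s | s <= 1])).
    apply: closed_bigI => r _; apply: closed_comp; last exact: closed_le.
    by move=> x _; exact: continuous_wsum.
  by apply/seteqP; split => x h r; [move=> _; exact: h|exact: (h r)].
(* Zero entries have inverse 0, so this sum dominates the inverse of every positive entry, and no
   row has to be chosen for each coordinate. *)
- pose B := \sum_(i < d) \sum_r (A r i)^-1.
  exists B; split; first exact: num_real.
  move=> M BM x xA.
  have AV r i : 0 <= (A r i)^-1 by rewrite invr_ge0.
  rewrite /= [leLHS]/Num.Def.normr /= mx_normrE; apply: bigmax_le =>
    [|[i0 i] _ /=].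
    by rewrite (le_trans _ (ltW BM))// sumr_ge0// => i _; apply: sumr_ge0.
  rewrite (ord1 i0); apply: le_trans (ltW BM).
  have [r rp] := Ap i.
  apply: (@le_trans _ _ (A r i)^-1).
    rewrite -[leRHS]mul1r ler_pdivlMr// mulrC.
    apply: le_trans (xA r); rewrite (bigD1 i)//= lerDl sumr_ge0// => j _.
    by rewrite mulr_ge0.
  rewrite /B (bigD1 i)//= (bigD1 r)//= -addrA lerDl addr_ge0 ?sumr_ge0// => j _.
  exact: sumr_ge0.
- move=> x y l; rewrite !inE => xA yA r.
  have l0 : 0 <= l%:num by [].
  have l1 : 0 <= 1 - l%:num by rewrite subr_ge0.
  apply: (@le_trans _ _ (l%:num * (\sum_(i < d) A r i * `|x ord0 i|) +
    (1 - l%:num) * (\sum_(i < d) A r i * `|y ord0 i|))).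
    rewrite !mulr_sumr -big_split/=; apply: ler_sum => i _.
    rewrite !mxE mulrCA [X in _ <= _ + X]mulrCA -mulrDr ler_wpM2l//.
    by rewrite (le_trans (ler_normD _ _))// !normrM (ger0_norm l0)
      (ger0_norm l1).
  rewrite -[leRHS](subrK l%:num) addrC; apply: lerD.
    by rewrite -[leRHS]mulr1 ler_wpM2l.
  by rewrite -[leRHS]mulr1 ler_wpM2l.
- exists 0; rewrite /interior/=.
  apply: (@filter_forall _ I (fun r => [set x : 'rV[R]_d | \sum_(i < d) A r i *
    `|x ord0 i| <= 1]) (nbhs (0 : 'rV[R]_d))) => r.
  have H : nbhs (0 : 'rV[R]_d) [set x : 'rV[R]_d | \sum_(i < d) A r i * `|x
    ord0 i| < 1].
    apply: (@continuous_wsum (A r) 0 [set s | s < 1]).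
    rewrite big1; last by move=> i _; rewrite mxE normr0 mulr0.
    exact: lt_nbhsl.
  by apply: filterS H => x /ltW.
Qed.

Lemma unconditional_polytope A : unconditional (polytope A).
Proof.
move=> e.
have flip x : polytope A x -> polytope A (\row_i ((-1) ^+ e i * x ord0 i)).
  move=> xA r; have := xA r; congr (_ <= _); apply: eq_bigr => i _.
  by rewrite mxE normrM normr_sign mul1r.
apply/seteqP; split => [_ [x xA <-]|x xA]; first exact: flip.
exists (\row_i ((-1) ^+ e i * x ord0 i)); first exact: flip.
by apply/rowP => i; rewrite !mxE mulrA -signr_addb addbb mul1r.
Qed.

End polytope_body.

(** * A body with long needles *)

Section needle_body.
Context {R : realType} (m N : nat) (lam : nat -> nat).
Local Notation d := (m + N)%N.
Local Notation mu := (@lebesgue_tuple R d).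

(** The rows [Some _] describe the bipyramid and the row [None] the cut. *)
Definition needle_rows (r : option (option 'I_d)) (i : 'I_d) : R :=
  match r with
  | None => ((i < m)%N * lam i)%:R
  | Some None => (i < m)%N%:R
  | Some (Some l) => ((i < m)%N || (i == l))%:R
  end.

Lemma in_poly_needle t : in_poly needle_rows t =
  bipyr m 1 t && (\sum_(i < d) ((i < m)%N * lam i)%:R * `|tnth t i| <= 1).
Proof.
apply/forallP/andP => [h|[/andP[h1 /forallP h2] h3] [[l|]|]]; last 3 first.
- exact: h2.
- exact: h1.
- exact: h3.
- split; last exact: (h None).
  apply/andP; split; first exact: (h (Some None)).
  by apply/forallP => l; exact: (h (Some (Some l))).
Qed.

Lemma needle_rows_ge0 r i : 0 <= needle_rows r i.
Proof. by case: r => [[l|]|]; exact: ler0n. Qed.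

Local Notation delta := (3 / d%:R * (\sum_(i < d) (i < m)%N * lam i)%N%:R : R).
Local Notation coef0 := (bipyr_coef d m (fun=> 0%N) : R).

Lemma needle_moment (a : nat -> nat) : (forall i, a i <= 2)%N ->
  exists2 M : R,
    (\int[mu]_t ((in_poly needle_rows t)%:R * abs_monomial a t)%:E = M%:E)%E &
    (1 - delta) * bipyr_coef d m a <= M <= bipyr_coef d m a.
Proof.
move=> a2.
have [||//|M hM] := @integral_bipyr_cut R d m
  (fun i : 'I_d => ((i < m)%N * lam i)%:R) a.
- by move=> i; exact: ler0n.
- by move=> i mi; rewrite ltnNge mi.
- rewrite -natr_sum => ?; exists M => //.
  by rewrite -hM; apply: eq_integral => t _; rewrite in_poly_needle.
Qed.

Lemma bipyr_coef_square_exp_lt (i : 'I_d) : (i < m)%N ->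
  bipyr_coef d m (square_exp i) = 2 / (d.+1%:R * d.+2%:R) * coef0.
Proof.
move=> im; rewrite (_ : square_exp i = incr_exp (incr_exp (fun=> 0%N) i) i);
  last first.
  by apply/funext => j; rewrite /square_exp /incr_exp add0n addnn.
rewrite bipyr_coef_inc// (_ : \sum_(j < d) _ = 1)%N; last first.
  rewrite (bigD1 i)//= /incr_exp eqxx big1 ?addn0// => j.
  by rewrite -val_eqE => /negbTE ->.
by rewrite bipyr_coef_inc// big1// addn0 addn1 /incr_exp eqxx add0n mulrA
  mulf_div mulr1 [in RHS](mulrC d.+1%:R).
Qed.

(** Larger than the needle value by the factor [(N + 1) * (N + 2) / 6]. This gap is what lets the
    isotropic rescaling push the lattice off these coordinates. *)
Lemma bipyr_coef_square_exp_ge (i : 'I_d) : (m <= i)%N ->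
  bipyr_coef d m (square_exp i) =
  (N.+1%:R * N.+2%:R) / (3 * (d.+1%:R * d.+2%:R)) * coef0.
Proof.
move=> mi; have := @bipyr_coef_sq R d m i mi (ltn_ord i).
rewrite addKn !natrM -mulrA => /(canRL (mulfK _)) ->.
  by rewrite -[LHS]mulrA [LHS]mulrC.
by rewrite !mulf_neq0// pnatr_eq0.
Qed.

End needle_body.

(** * An isotropic body with prescribed lattice points *)

Section exists_body.
Context {R : realType}.

Lemma exists_needle_scaling m N (lam : nat -> nat) (delta : R) :
  let d := (m + N)%N in
  0 < delta < 1 -> (0 < d)%N ->
  3 / d%:R * (\sum_(i < d) (i < m)%N * lam i)%N%:R <= delta ->
  exists theta : 'I_d -> R,
    [/\ forall i, 0 < theta i,
        forall i : 'I_d, (i < m)%N -> 1 - delta <= theta i <= 1,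
        forall i : 'I_d, (m <= i)%N ->
          (1 - delta) ^+ 2 * (N.+1%:R * N.+2%:R) / 6 <= theta i ^+ 2 &
        isotropic (polytope (scale_rows (@needle_rows R m N lam)
          (fun i => (theta i)^-1)))].
Proof.
move=> d /andP[delta0 delta1] d0 hd.
have e0 : 0 < 1 - delta by rewrite subr_gt0.
pose c0 : R := bipyr_coef d m (fun=> 0%N).
have c00 : 0 < c0 by exact: bipyr_coef_gt0.
have bnd (a : nat -> nat) : (forall i, a i <= 2)%N -> {M : R |
    (\int[@lebesgue_tuple R d]_t ((in_poly (@needle_rows R m N lam) t)%:R *
      abs_monomial a t)%:E = M%:E)%E /\
    (1 - delta) * bipyr_coef d m a <= M <= bipyr_coef d m a}.
  move=> a2; apply: cid.
  have [M hM /andP[M1 M2]] := @needle_moment R m N lam a a2.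
  exists M; split => //; rewrite M2 andbT; apply: le_trans M1.
  apply: ler_wpM2r; first by rewrite ltW// bipyr_coef_gt0.
  by rewrite lerD2l lerN2.
have sq2 (i : 'I_d) j : (square_exp i j <= 2)%N by rewrite /square_exp;
  case: (_ == _).
have [V [hV /andP[V1 V2]]] := bnd (fun=> 0%N) (fun=> isT).
pose M i := sval (bnd (square_exp i) (sq2 i)).
have hM i : (\int[@lebesgue_tuple R d]_t ((in_poly (@needle_rows R m N lam)
  t)%:R * abs_monomial (square_exp i) t)%:E = (M i)%:E)%E.
  by rewrite /M; case: (bnd _ _) => ? [].
have Mb i : (1 - delta) * bipyr_coef d m (square_exp i) <= M i <=
  bipyr_coef d m (square_exp i).
  by rewrite /M; case: (bnd _ _) => ? [].
have V0 : 0 < V by apply: lt_le_trans V1; exact: mulr_gt0.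
have M0 i : 0 < M i.
  by case/andP: (Mb i) => + _; apply: lt_le_trans;
    rewrite mulr_gt0 ?bipyr_coef_gt0.
pose s : R := 2 / (d.+1%:R * d.+2%:R).
have s0 : 0 < s by rewrite divr_gt0// mulr_gt0.
(* [s] is the variance of a needle coordinate before the cut; the factor
   [1 - delta] makes all the [theta i] of the needles at most 1. *)
pose L := Num.sqrt (s / (1 - delta)).
have L0 : 0 < L by rewrite sqrtr_gt0 divr_gt0.
have L2 : L ^+ 2 = s / (1 - delta) by rewrite sqr_sqrtr// divr_ge0// ltW.
(* Forced by the condition [c i ^+ 2 * M i = L ^+ 2 * V] of [isotropic_polytope] with
   [c i = (theta i)^-1]. *)
pose theta i := Num.sqrt (M i / (V * L ^+ 2)).
have t0 i : 0 < theta i by rewrite sqrtr_gt0 divr_gt0// mulr_gt0// exprn_gt0.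
have t2 i : theta i ^+ 2 = M i / (V * L ^+ 2).
  by rewrite sqr_sqrtr// divr_ge0// ?ltW// mulr_gt0// exprn_gt0.
have VL0 : 0 < V * L ^+ 2 by rewrite mulr_gt0// exprn_gt0.
exists theta; split=> //.
- move=> i im; have := Mb i; rewrite (bipyr_coef_square_exp_lt im) -/c0 -/s =>
    /andP[Ml Mu].
  apply/andP; split.
    rewrite -(@ler_pXn2r _ 2)// ?nnegrE ?(ltW e0)// ?(ltW (t0 i))// t2
      ler_pdivlMr// L2.
    rewrite mulrA expr2 -2!mulrA.
    apply: le_trans Ml; rewrite ler_pM2l//.
    rewrite (_ : (1 - delta) * _ = V * s); last by field; rewrite gt_eqF.
    by rewrite mulrC ler_pM2l.
  rewrite -(@ler_pXn2r _ 2)// ?nnegrE ?(ltW (t0 i))// t2 ler_pdivrMr// L2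
    expr1n mul1r.
  apply: (le_trans Mu); rewrite mulrC mulrA ler_pdivlMr// mulrAC ler_pM2r//.
  by rewrite mulrC.
- move=> i im; have := Mb i; rewrite (bipyr_coef_square_exp_ge im) -/c0 =>
    /andP[Ml _].
  rewrite t2 ler_pdivlMr// L2; apply: le_trans Ml.
  set n1 := N.+1%:R * N.+2%:R.
  have n10 : 0 < n1 by rewrite mulr_gt0.
  rewrite (_ : _ * (V * _) = (1 - delta) *
    (n1 / (3 * (d.+1%:R * d.+2%:R)) * V)); last first.
    rewrite /s; field; rewrite -[1]/(1%:R) -!natrD !pnatr_eq0/= gt_eqF//.
  by apply: ler_wpM2l; [exact: ltW|apply: ler_wpM2l => //;
    rewrite ltW// divr_gt0// !mulr_gt0].
- apply: (isotropic_polytope (V := V) (L := L) (M := M)) => //.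
    by move=> i; rewrite invr_gt0.
  move=> i; rewrite exprVn t2 invf_div -mulrA mulVf ?mulr1;
    last by rewrite gt_eqF.
  by rewrite mulrC.
Qed.

(** Rounding: outside the needles [theta i > B >= k], so a nonzero integer violates its row. On the
    needles [theta i >= 1 - delta] and [(1 - delta) * (k + 1) > k], so the integer sum in the cut
    cannot reach [k + 1]. *)
Lemma exists_needle_body m (lam : nat -> nat) (B : nat) :
  (0 < B)%N -> (forall i, (i < m)%N -> (0 < lam i <= B)%N) ->
  exists d : nat, exists G : set 'rV[R]_d,
    [/\ (m <= d)%N, (B ^ 2 <= d)%N,
        [/\ convex_body G, unconditional G & isotropic G] &
        forall (k : nat) (y : 'rV[int]_d), (0 < k <= B)%N ->
          lattice_points (dilate k%:R G) y <->
          (forall i : 'I_d, (m <= i)%N -> y ord0 i = 0) /\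
          (\sum_(i < d) ((i < m) * lam i) * `|y ord0 i| <= k)%N].
Proof.
move=> B0 hlam.
(* The first summand yields [delta * (B + 1) < 1], the second leaving room for the extra term of
   [delta]. The second also gives [B ^ 2 <= d] and [N >= 5 * B], whence
   [theta i ^+ 2 >= N^2 / 24 > B^2] outside the needles. *)
pose N := (3 * m * B * B.+1 + 5 * B ^ 2)%N.
have N0 : (0 < N)%N by rewrite /N; move: B0; clear; nia.
pose d := (m + N)%N; exists d.
have d0 : (0 < d)%N by rewrite addn_gt0 N0 orbT.
(* The second summand keeps [delta] positive when [m = 0]. *)
pose delta : R := 3 / d%:R * (m * B)%:R + (2 * d%:R * B.+1%:R)^-1.
have d0R : 0 < d%:R :> R by rewrite ltr0n.
have del0 : 0 < delta by rewrite ltr_wpDl// ?invr_gt0 ?mulr_gt0// mulr_ge0//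
  divr_ge0.
have delB : delta * B.+1%:R < 1.
  rewrite /delta mulrDl (_ : (_)^-1 * _ = (2 * d%:R)^-1); last first.
    by field; rewrite -[1]/(1%:R) -!natrD !pnatr_eq0 gt_eqF.
  rewrite (_ : _ + _ = (6 * (m * B) * B.+1 + 1)%N%:R / (2 * d%:R)); last first.
    rewrite natrD !natrM; field; by rewrite gt_eqF.
  rewrite ltr_pdivrMr ?mulr_gt0// mul1r -natrM ltr_nat /d /N.
  by move: B0; clear; nia.
have del1 : delta < 1.
  by apply: le_lt_trans delB; rewrite ler_peMr ?(ltW del0)// ler1n.
have delhalf : 2^-1 <= 1 - delta.
  have : delta * 2 <= 1.
    apply: le_trans (ltW delB); rewrite ler_wpM2l ?(ltW del0)// ler_nat//.
  by move=> h; lra.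
have sumB : 3 / d%:R * (\sum_(i < d) (i < m)%N * lam i)%N%:R <= delta.
  rewrite /delta -[leLHS]addr0 lerD// ?invr_ge0 ?mulr_ge0//.
  rewrite ler_wpM2l ?divr_ge0// ler_nat.
  rewrite -[X in (X <= _)%N](big_mkord xpredT (fun i => (i < m) * lam i)%N).
  rewrite (@big_cat_nat _ _ _ m)//= ?leq_addr//.
  rewrite [X in (_ + X)%N]big_nat_cond [X in (_ + X)%N]big1; last first.
    by move=> i /andP[/andP[mi _] _]; rewrite ltnNge mi.
  rewrite addn0 big_mkord; apply: (@leq_trans (\sum_(i < m) B));
    last by rewrite sum_nat_const card_ord.
  by apply: leq_sum => i _; rewrite ltn_ord mul1n;
    case/andP: (hlam i (ltn_ord i)).
have [|theta [t0 ty tz iso]] := @exists_needle_scaling m N lam delta _ d0 sumB.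
  by rewrite del0 del1.
have tzB (i : 'I_d) : (m <= i)%N -> B%:R < theta i.
  move=> mi; rewrite -(@ltr_pXn2r _ 2)// ?nnegrE ?(ltW (t0 i))//.
  apply: lt_le_trans (tz i mi).
  rewrite ltr_pdivlMr//.
  have : 2^-1 ^+ 2 * (N.+1%:R * N.+2%:R) <=
    (1 - delta) ^+ 2 * (N.+1%:R * N.+2%:R) :> R.
    by rewrite ler_wpM2r ?mulr_ge0// ler_pXn2r ?nnegrE// subr_ge0 ltW.
  apply: lt_le_trans.
  have NB : (5 * B <= N)%N by rewrite /N; move: B0; clear; nia.
  have NBR : 5 * B%:R <= N%:R :> R by rewrite -natrM ler_nat.
  have BR : 0 <= B%:R :> R by [].
  have sq : (5 * B%:R) * (5 * B%:R) <= N%:R * N%:R :> R by rewrite ler_pM.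
  rewrite -[N.+2%:R]natr1 -[N.+1%:R]natr1 exprVn -natrX.
  move: (N%:R : R) (B%:R : R) NBR BR sq => n b *; nra.
pose A := @needle_rows R m N lam.
pose c i := (theta i)^-1.
have A'E r i : scale_rows A c r i = A r i * theta i by rewrite /scale_rows /c
  invrK.
exists (polytope (scale_rows A c)); split.
- exact: leq_addr.
- by rewrite /d /N; move: B0; clear; nia.
- split; [apply: convex_body_polytope|exact: unconditional_polytope|exact: iso].
    by move=> r i; rewrite A'E mulr_ge0 ?needle_rows_ge0// ltW.
  by move=> i; exists (Some (Some i)); rewrite A'E mulr_gt0//= eqxx orbT.
move=> k y /andP[k0 kB].
have k0R : 0 < k%:R :> R by rewrite ltr0n.
have dilE : lattice_points (dilate k%:R (polytope (scale_rows A c))) y <->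
    forall r, \sum_(i < d) A r i * theta i * (`|y ord0 i|%N)%:R <= k%:R.
  have E r (x : 'rV[R]_d) : k%:R *: x = map_mx intr y ->
    k%:R * (\sum_(i < d) scale_rows A c r i * `|x ord0 i|) =
      \sum_(i < d) A r i * theta i * (`|y ord0 i|%N)%:R.
    move=> xy; rewrite mulr_sumr; apply: eq_bigr => i _.
    rewrite A'E mulrCA; congr (_ * _).
    have := congr1 (fun z : 'rV[R]_d => `|z ord0 i|) xy;
      rewrite !mxE normrM ger0_norm// => ->.
    by rewrite -intr_norm natr_absz.
  split => [[x xA xy] r|h].
    by rewrite -(E r x xy) -[leRHS]mulr1 ler_pM2l//; exact: xA.
  exists (k%:R^-1 *: map_mx intr y); last by rewrite scalerA divff ?scale1r//
    gt_eqF.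
  move=> r; rewrite -(@ler_pM2l _ k%:R)// (E r) ?mulr1//.
  by rewrite scalerA divff ?scale1r// gt_eqF.
rewrite dilE; split => [h|[hz hs] r].
- have hz (i : 'I_d) : (m <= i)%N -> y ord0 i = 0.
    move=> mi; apply/eqP; rewrite -absz_eq0; apply/negPn/negP; rewrite -lt0n =>
      yi.
    have := h (Some (Some i)); apply/negP; rewrite -ltNge.
    rewrite (bigD1 i)//= eqxx orbT mul1r.
    apply: (@lt_le_trans _ _ (theta i)).
      by apply: le_lt_trans (tzB i mi); rewrite ler_nat.
    apply: (@le_trans _ _ (theta i * (`|y ord0 i|%N)%:R)).
      by rewrite ler_peMr ?ler1n// ltW.
    rewrite lerDl sumr_ge0// => j _; rewrite !mulr_ge0//; exact: ltW.
  split => //; rewrite leqNgt; apply/negP => hk.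
  have := h None; apply/negP; rewrite -ltNge.
  apply: (@lt_le_trans _ _ ((1 - delta) * k.+1%:R)).
    have : delta * k.+1%:R < 1.
      by apply: le_lt_trans delB; rewrite ler_wpM2l ?(ltW del0)// ler_nat.
    by rewrite mulrBl mul1r -natr1; lra.
  apply: (@le_trans _ _ ((1 - delta) * (\sum_(i < d) (i < m) * lam i * `|y ord0
    i|)%N%:R)).
    by rewrite ler_wpM2l ?ler_nat// subr_ge0 ltW.
  rewrite natr_sum mulr_sumr; apply: ler_sum => i _ /=.
  have [im|mi] := ltnP i m; last by rewrite !mul0n !mul0r mulr0.
  rewrite mul1n natrM mulrA [_ * (lam i)%:R]mulrC ler_wpM2r// ler_wpM2l//.
  by case/andP: (ty i im).
(* Conversely, on points supported on the needles the unscaled cut dominates every scaled row,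
   because [theta i <= 1 <= lam i]. *)
- apply: (@le_trans _ _ (\sum_(i < d) (i < m) * lam i * `|y ord0 i|)%N%:R);
    last by rewrite ler_nat.
  rewrite natr_sum; apply: ler_sum => i _.
  have [im|mi] := ltnP i m; last by rewrite hz// absz0 mulr0 muln0.
  rewrite natrM ler_wpM2r//.
  have [_ t1] := andP (ty i im).
  have l1 : (1 <= (lam i)%:R :> R) by rewrite ler1n; case/andP: (hlam i im).
  by rewrite -[leRHS]mulr1 ler_pM ?needle_rows_ge0 ?(ltW (t0 i))//; case: r =>
    [[l|]|] /=; rewrite im ?mul1n.
Qed.

End exists_body.

(** * Blocks of needles and parity *)

Section blocks.

(** The number of integer points of the box [[-2^k, 2^k]^p]: block [k] is as
    large as the set of lattice points that earlier blocks can contribute at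
    scale [2^k]. *)
Definition block_size (k p : nat) : nat := ((2 ^ k.+1).+1 ^ p)%N.

Fixpoint block_start (k : nat) : nat :=
  if k is k'.+1 then (block_start k' + block_size k' (block_start k'))%N else 0.

Lemma block_startS k : (block_start k < block_start k.+1)%N.
Proof. by rewrite -[X in (X < _)%N]addn0 ltn_add2l expn_gt0. Qed.

Lemma block_start_mono k l : (k <= l)%N -> (block_start k <= block_start l)%N.
Proof.
elim: l => [|l IH]; first by rewrite leqn0 => /eqP ->.
rewrite leq_eqVlt => /predU1P[->//|/IH h].
exact: leq_trans h (ltnW (block_startS l)).
Qed.

Lemma leq_block_start k : (k <= block_start k)%N.
Proof. by elim: k => // k IH; exact: leq_ltn_trans IH (block_startS k). Qed.

Lemma exists_block i : exists k, (i < block_start k.+1)%N.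
Proof. by exists i; exact: leq_block_start. Qed.

Definition block_of i := ex_minn (exists_block i).

Lemma block_ofP i :
  (block_start (block_of i) <= i < block_start (block_of i).+1)%N.
Proof.
rewrite /block_of; case: ex_minnP => k ik kmin; rewrite ik andbT.
case: k ik kmin => // k _ kmin; rewrite leqNgt; apply/negP => /kmin.
by rewrite ltnn.
Qed.

Lemma block_of_eq i k :
  (block_start k <= i < block_start k.+1)%N = (block_of i == k).
Proof.
apply/idP/eqP => [/andP[ki ik]|<-]; last exact: block_ofP.
have /andP[bi ib] := block_ofP i.
apply/eqP; rewrite eqn_leq; apply/andP; split; rewrite leqNgt; apply/negP => h.
  by have := leq_trans ik (leq_trans (block_start_mono h) bi); rewrite ltnn.
by have := leq_trans ib (leq_trans (block_start_mono h) ki); rewrite ltnn.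
Qed.

Lemma block_of_lt i k : (i < block_start k)%N -> (block_of i < k)%N.
Proof.
move=> ik; rewrite ltnNge; apply/negP => /block_start_mono h.
have /andP[bi _] := block_ofP i.
by have := leq_trans ik (leq_trans h bi); rewrite ltnn.
Qed.

End blocks.

(** * Lattice points of the dyadic dilates *)

Section lattice.
Context (n d : nat).
Local Notation m := (block_start n).
Context (md : (m <= d)%N).

Definition weighted_ball (k : nat) (y : 'rV[int]_d) : Prop :=
  (forall i : 'I_d, (m <= i)%N -> y ord0 i = 0) /\
  (\sum_(i < d) ((i < m) * 2 ^ block_of i) * `|y ord0 i| <= 2 ^ k)%N.

Definition signed_unit (p : 'I_d * bool) : 'rV[int]_d :=
  \row_j ((j == p.1)%:R * (-1) ^+ p.2).

Definition block_mem (k : nat) (i : 'I_d) : bool := block_of i == k.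

Lemma card_block k : (k < n)%N ->
  #|[pred i : 'I_d | block_mem k i]| = block_size k (block_start k).
Proof.
move=> kn.
have bd (j : 'I_(block_size k (block_start k))) : (block_start k + j < d)%N.
  apply: leq_trans md; apply: leq_trans (block_start_mono kn).
  by rewrite /= ltn_add2l.
have inj : injective (fun j => Ordinal (bd j)).
  by move=> i j /(congr1 val)/= /addnI /val_inj.
rewrite -[RHS]card_ord -(card_codom inj); apply: eq_card => i.
rewrite inE /block_mem -block_of_eq; apply/idP/codomP => [/andP[ki ik]|[j ->]].
  have h : (i - block_start k < block_size k (block_start k))%N by rewrite
    ltn_subLR.
  by exists (Ordinal h); apply/val_inj; rewrite /= subnKC.
by rewrite /= leq_addr ltn_add2l ltn_ord.
Qed.

Lemma signed_unit_weighted_ball k p : (k < n)%N -> block_mem k p.1 ->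
    weighted_ball k (signed_unit p).
Proof.
move=> kn /eqP bk.
have pm : (p.1 < m)%N.
  have /andP[_ h] := block_ofP p.1; apply: leq_trans h _.
  by rewrite bk; exact: block_start_mono.
split=> [i mi|].
  by rewrite mxE [_ == _](negbTE _) ?mul0r// -val_eqE neq_ltn (leq_trans pm mi)
    orbT.
rewrite (bigD1 p.1)//= big1 => [|i /negbTE ip].
  by rewrite mxE eqxx mul1r pm bk mul1n addn0 abszX (_ : `|(-1)%Z|%N = 1%N)//
    exp1n muln1.
by rewrite mxE ip mul0r absz0 muln0.
Qed.

(** A nonzero coordinate in block [k] has weight [2 ^ k] and uses up the whole budget, so it is 1 or
    -1 and stands alone; in a later block even one unit exceeds the budget. What remains lies in a
    box over the earlier blocks. *)
Lemma weighted_ball_cases k y : (k < n)%N -> weighted_ball k y ->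
  (exists2 p, block_mem k p.1 & y = signed_unit p) \/
  (forall i : 'I_d, (`|y ord0 i| <= 2 ^ k)%N /\
    ((block_start k <= i)%N -> y ord0 i = 0)).
Proof.
move=> kn [y0 ys].
have term (i : 'I_d) : (i < m)%N -> (2 ^ block_of i * `|y ord0 i| <= 2 ^ k)%N.
  by move=> im; apply: leq_trans ys; rewrite (bigD1 i)//= im mul1n leq_addr.
have [/existsP[i /andP[/eqP bi yi]]|/existsPn H] := boolP
  [exists i, block_mem k i && (y ord0 i != 0)].
  left.
  have im : (i < m)%N.
    by rewrite ltnNge; apply: contraNN yi => /y0 ->.
  have yi1 : `|y ord0 i|%N = 1%N.
    have := term i im; rewrite bi -{2}[(2 ^ k)%N]muln1 leq_pmul2l ?expn_gt0//
      => h.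
    by apply/eqP; rewrite eqn_leq h lt0n absz_eq0.
  exists (i, y ord0 i == -1); first exact/eqP.
  apply/rowP => j; rewrite !mxE /=.
  have [->|ji] := eqVneq j i.
    by move: yi1; clear; case: (y ord0 i) => [[|[|?]]|[|?]].
  rewrite mul0r; apply/eqP; rewrite -absz_eq0.
  have [jm|/y0 ->//] := ltnP j m.
  move: ys; rewrite (bigD1 i)//= im bi mul1n yi1 muln1 -{2}[(2 ^ k)%N]addn0
    leq_add2l.
  rewrite (bigD1 j)//= jm mul1n leqn0 addn_eq0 muln_eq0 expn_eq0/=.
  by case/andP.
right => i.
have [im|mi] := ltnP i m; last by rewrite y0// absz0.
split; first by apply: leq_trans (term i im); rewrite leq_pmull// expn_gt0.
move=> ki; apply/eqP; apply: contraT => yi.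
have := H i; rewrite yi andbT /block_mem -block_of_eq ki/= -leqNgt => ki'.
have kb : (k < block_of i)%N.
  rewrite ltnNge; apply/negP => bk.
  have /andP[_ h] := block_ofP i.
  have := leq_trans h (leq_trans (block_start_mono
    (bk : (block_of i).+1 <= k.+1)%N) ki').
  by rewrite ltnn.
have := term i im; rewrite leqNgt => /negP; case.
apply: (@leq_trans (2 ^ block_of i)); first by rewrite ltn_exp2l.
by rewrite leq_pmulr// lt0n absz_eq0.
Qed.

(** By the choice of [block_size], block [k] has as many coordinates as the box over the earlier
    blocks has points: two signed units per coordinate plus the box give the factor 3. *)
Lemma card_weighted_ball k (A : {fset 'rV[int]_d}) : (k < n)%N ->
  (forall y, y \in A -> weighted_ball k y) ->
  (#|` A| <= 3 * block_size k (block_start k))%N.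
Proof.
move=> kn hA.
(* Enumerates the box: ordinals are shifted by [2 ^ k] to cover the integers from [- 2 ^ k] to
   [2 ^ k], and coordinates from [block_start k] on are filled with 0. *)
pose u (g : {ffun 'I_(block_start k) -> 'I_(2 ^ k.+1).+1}) : 'rV[int]_d :=
  \row_j (if insub (val j) is Some j' then (g j')%:Z - (2 ^ k)%:Z else 0).
pose s := [seq signed_unit (i, b) | i <- enum [pred i : 'I_d | block_mem k i],
  b <- [:: true; false]] ++
          [seq u g | g <- enum {ffun 'I_(block_start k) -> 'I_(2 ^ k.+1).+1}].
have ss : size s = (3 * block_size k (block_start k))%N.
  rewrite size_cat size_allpairs size_map -!cardE card_block//.
  by rewrite card_ffun !card_ord -/(block_size _ _) mulnC -mulSnr.
rewrite -ss; apply: uniq_leq_size => [|y yA]; first exact: fset_uniq.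
rewrite mem_cat; have [[[i b] bi ->]|h] := weighted_ball_cases kn (hA _ yA).
  apply/orP; left; apply: (allpairs_f (fun i b => signed_unit (i, b))).
    by rewrite mem_enum inE.
  by case: (b).
apply/orP; right; apply/mapP.
have dk : (block_start k <= d)%N.
  by apply: leq_trans md; apply: block_start_mono; exact: ltnW.
exists [ffun j => inord (absz (y ord0 (widen_ord dk j) + (2 ^ k)%:Z)%R)];
  first by rewrite mem_enum.
apply/rowP => j; rewrite mxE; case: insubP => /= [j' _ jj'|].
  rewrite ffunE (_ : widen_ord dk j' = j); last exact/val_inj.
  have [hj _] := h j.
  have [pos ub] : 0 <= y ord0 j + (2 ^ k)%:Z /\
    (absz (y ord0 j + (2 ^ k)%:Z)%R < (2 * 2 ^ k).+1)%N.
    by move: hj; move: (y ord0 j) (2 ^ k)%N => z q; lia.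
  by rewrite inordK ?expnS// gez0_abs// addrK.
by rewrite -leqNgt => /(proj2 (h j)).
Qed.

(** * Cube points with even parity in every block *)

Section parity.
Implicit Types (g : {ffun 'I_d -> bool}).

Definition cube_pt g : 'rV[int]_d := \row_i (g i)%:R.

Lemma cube_pt_inj : injective cube_pt.
Proof.
move=> g h /rowP gh; apply/ffunP => i; have := gh i; rewrite !mxE.
by case: (g i) (h i) => [] [].
Qed.

Definition block_parity g k : bool := \big[addb/false]_(i | block_mem k i) g i.

Definition flip g (i : 'I_d) : {ffun 'I_d -> bool} :=
  [ffun j => g j (+) (j == i)].

Lemma flipK i : cancel (flip^~ i) (flip^~ i).
Proof. by move=> g; apply/ffunP => j; rewrite !ffunE addbK. Qed.

Lemma block_parity_flip g i k :
  block_parity (flip g i) k = block_parity g k (+) block_mem k i.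
Proof.
rewrite /block_parity; under eq_bigr do rewrite ffunE.
rewrite big_split/=; congr (_ (+) _).
have [bi|bi] := boolP (block_mem k i).
  by rewrite (bigD1 i)//= eqxx big1// => j /andP[_ /negbTE].
by rewrite big1// => j bj; apply/negbTE; apply: contraNN bi => /eqP <-.
Qed.

Lemma cube_pt_flip g i :
  cube_pt g - cube_pt (flip g i) = signed_unit (i, ~~ g i).
Proof.
apply/rowP => j; rewrite !mxE ffunE /=; have [->|_] := eqVneq j i.
  by rewrite addbT mul1r; case: (g i).
by rewrite addbF subrr mul0r.
Qed.

Definition even_cube : {set {ffun 'I_d -> bool}} :=
  finset (fun g : {ffun 'I_d -> bool} =>
    [forall i, g i ==> (i < m)%N] && [forall k : 'I_n, ~~ block_parity g k]).

Definition in_even (x : 'rV[int]_d) : bool :=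
  [exists g in even_cube, cube_pt g == x].

(** The first index of block [k]. Flipping this one fixed index turns even points into points that
    are odd in block [k] only, without loss of cardinality. *)
Definition pivot (k : 'I_n) : 'I_d :=
  Ordinal (leq_trans (leq_trans (block_startS k)
    (block_start_mono (ltn_ord k))) md).

Lemma block_mem_pivot k l : block_mem l (pivot k) = (k == l :> nat).
Proof.
rewrite /block_mem; congr (_ == _); apply/eqP.
by rewrite -block_of_eq /= leqnn block_startS.
Qed.

(** The parities of the flipped point reveal which block was flipped. *)
Lemma flip_pivot_inj :
  {in [pred kg : 'I_n * {ffun 'I_d -> bool} | kg.2 \in even_cube] &,
    injective (fun kg => flip kg.2 (pivot kg.1))}.
Proof.
move=> [k g] [l h]; rewrite !inE /= => /andP[_ /forallP gp]
  /andP[_ /forallP hp] gh.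
have kl : k = l.
  have := congr1 (fun g => block_parity g k) gh.
  rewrite /= !block_parity_flip !block_mem_pivot eqxx (negbTE (gp k))
    (negbTE (hp k)) /= => /esym/eqP lk.
  exact/val_inj.
by rewrite kl in gh *; rewrite (can_inj (flipK _) gh).
Qed.

(** Flipping any index [i] of block [k] restores its parity, and the step is a signed unit whose
    sign depends on the current bit, so that the cube is not left. Distinct [i] give distinct
    steps. *)
Lemma even_hits (k : 'I_n) g (A : {fset 'rV[int]_d}) : g \in even_cube ->
  (forall y, weighted_ball k y -> y \in A) ->
  (block_size k (block_start k) <=
    count (fun y => in_even (cube_pt (flip g (pivot k)) - y)) A)%N.
Proof.
move=> gE hA; set h := flip g _.
rewrite -card_block// cardE -(size_map (fun i => signed_unit (i, ~~ h i)))
  -size_filter.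
apply: uniq_leq_size.
  rewrite map_inj_uniq ?enum_uniq// => i j /rowP /(_ i); rewrite !mxE eqxx /=.
  case: eqP => // _; rewrite mul0r mul1r => /eqP.
  by rewrite signr_eq0.
move=> y yin; have [i + ->] := mapP yin; rewrite mem_enum inE => bi.
rewrite mem_filter hA ?andbT; last exact: signed_unit_weighted_ball.
rewrite -cube_pt_flip opprB addrC subrK.
apply/existsP; exists (flip h i); rewrite eqxx andbT.
move: gE; rewrite !inE => /andP[/forallP gm /forallP gp].
have bm j : block_mem k j -> (j < m)%N.
  move=> /eqP bj; have /andP[_] := block_ofP j; rewrite bj => jk.
  exact: leq_trans jk (block_start_mono (ltn_ord k)).
apply/andP; split; apply/forallP => j.
  rewrite !ffunE; apply/implyP => H.
  have [ji|ji] := eqVneq j i; first by rewrite ji bm.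
  have [jp|jp] := eqVneq j (pivot k); first by rewrite jp bm// block_mem_pivot
    eqxx.
  by apply: (implyP (gm j)); move: H; rewrite (negbTE ji) (negbTE jp) !addbF.
rewrite !block_parity_flip (negbTE (gp j)) block_mem_pivot.
have [jk|jk] := eqVneq k j; first by rewrite -jk bi eqxx.
rewrite /= (_ : (k == j :> nat) = false) /=; last by apply/negbTE.
by move: bi; rewrite /block_mem => /eqP ->; rewrite -val_eqE in jk.
Qed.

Lemma even_cube0 : [ffun=> false] \in even_cube.
Proof.
rewrite inE; apply/andP; split; apply/forallP => i; first by rewrite ffunE.
by rewrite /block_parity big1// => j _; rewrite ffunE.
Qed.

End parity.
End lattice.

(** * Extended sums over finitely many points *)

Section finite_esum.
Context {R : realType} {I : finType} {T : choiceType}.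

Lemma esum_image_finType (P : pred I) (e : I -> T) (a : T -> \bar R) :
  (forall x, 0 <= a x)%E -> {in P &, injective e} ->
  (\esum_(x in e @` [set i | P i]) a x = \sum_(i | P i) a (e i))%E.
Proof.
move=> a0 einj; rewrite esum_image; last first.
  by move=> i j; rewrite !inE; exact: einj.
rewrite esum_fset//; last exact: finite_finset.
rewrite -(@bigfs _ _ _ _ (index_enum I) P)//; first exact: index_enum_uniq.
by move=> i _; rewrite mem_index_enum.
Qed.

Lemma esumT_supported (S : set T) (a : T -> \bar R) :
  (forall x, ~ S x -> a x = 0)%E ->
  (\esum_(x in setT) a x = \esum_(x in S) a x)%E.
Proof.
move=> aS; rewrite [RHS]esum_mkcond; apply: eq_esum => x _.
by case: ifPn => // /negP; rewrite inE => /aS.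
Qed.

Lemma le_esumT (S : set T) (a : T -> \bar R) :
  (forall x, 0 <= a x)%E -> (\esum_(x in S) a x <= \esum_(x in setT) a x)%E.
Proof.
by move=> a0; rewrite esum_mkcond; apply: le_esum => x _; case: ifP.
Qed.

End finite_esum.

Lemma finite_box d q :
  finite_set [set y : 'rV[int]_d | forall i, (`|y ord0 i| <= q)%N].
Proof.
pose u (g : {ffun 'I_d -> 'I_(q + q).+1}) : 'rV[int]_d := \row_i
  ((g i)%:Z - q%:Z).
apply: (@sub_finite_set _ _ (range u)); last exact: finite_image.
move=> y hy; exists [ffun i => inord (absz (y ord0 i + q%:Z)%R)] => //.
apply/rowP => i; rewrite mxE ffunE.
have [pos ub] : 0 <= y ord0 i + q%:Z /\ (absz (y ord0 i + q%:Z)%R <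
  (q + q).+1)%N.
  by move: (hy i); move: (y ord0 i) => z; lia.
by rewrite inordK// gez0_abs// addrK.
Qed.

Lemma weighted_ball_le n d k (y : 'rV[int]_d) : weighted_ball n k y ->
  (\sum_(i < d) `|y ord0 i| <= 2 ^ k)%N.
Proof.
move=> [y0 ys]; apply: leq_trans ys; apply: leq_sum => i _.
have [im|mi] := ltnP i (block_start n); last by rewrite y0// absz0.
by rewrite mul1n leq_pmull// expn_gt0.
Qed.

Lemma normc_nat (R : realType) (q : nat) : Normc.normc (q%:R : R[i]) = q%:R.
Proof.
by rewrite -(rmorph_nat (real_complex R)) /= expr0n /=
  addr0 sqrtr_sqr ger0_norm.
Qed.

(** * The maximal function *)

Section maximal_lower_bound.
Context {R : realType}.
Context (n d : nat) (md : (block_start n <= d)%N) (G : set 'rV[R]_d).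
Context (hd : ((2 ^ n) ^ 2 <= d)%N).
Context (hG : forall (k : nat) (y : 'rV[int]_d), (k < n)%N ->
  lattice_points (dilate (2 ^+ k) G) y <-> weighted_ball n k y).

Definition even_ind (x : 'rV[int]_d) : R[i] := (in_even n x)%:R.

(** Guarantees that [fset_set] in [discrete_avg] really lists the lattice points. *)
Lemma finite_lattice k : (k < n)%N ->
  finite_set (lattice_points (dilate (2 ^+ k) G)).
Proof.
move=> kn; apply: sub_finite_set (finite_box d (2 ^ k)) =>
  y /(hG _ kn) /weighted_ball_le h i /=.
by apply: leq_trans h; rewrite (bigD1 i)//= leq_addr.
Qed.

(** With [b] the size of block [k], at least [b] steps reach the support ([even_hits]) out of at
    most [3 * b] lattice points ([card_weighted_ball]). *)
Lemma discrete_avg_even_ind_ge (k : 'I_n) g : g \in even_cube n d ->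
  3^-1 <= Normc.normc
    (discrete_avg G (2 ^+ k) even_ind (cube_pt (flip g (pivot md k)))).
Proof.
move=> gE; rewrite /discrete_avg; set A := fset_set _.
have AP y : y \in A <-> weighted_ball n k y.
  rewrite in_fset_set; last exact: finite_lattice.
  by rewrite inE; exact: hG.
have hits := even_hits md gE (fun y => (AP y).2).
have card := card_weighted_ball md (ltn_ord k) (fun y => (AP y).1).
set x := cube_pt _ in hits *.
rewrite (_ : \sum_(y <- A) _ = (count (fun y => in_even n (x - y)) A)%:R);
  last first.
  by rewrite -sum1_count natr_sum [RHS]big_mkcond/=; apply: eq_bigr => y _;
    rewrite /even_ind; case: ifP.
rewrite Normc.normcM Normc.normcV !normc_nat.
set c := count _ _ in hits *.
have A0 : (0 < #|` A|)%N.
  have : (0 < c)%N by apply: leq_trans hits; rewrite expn_gt0.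
  by apply: contraTT; rewrite -!leqNgt => h; apply: leq_trans h;
    exact: count_size.
rewrite mulrC ler_pdivlMr ?ltr0n// mulrC ler_pdivrMr// -natrM ler_nat mulnC.
by apply: leq_trans card _; rewrite leq_mul2l hits orbT.
Qed.

(** All weights are at least 1, so the lattice points have l^1 norm at most [2 ^ k], which is below
    the square root of [d] by [hd]. *)
Lemma kappa_tilde_le k : (k < n)%N ->
  kappa_tilde (dilate (2 ^+ k) G) <= d%:R `^ (- 2^-1) :> R.
Proof.
move=> kn.
have d0 : (0 < d)%N by apply: leq_trans hd; rewrite !expn_gt0.
have d0R : 0 < d%:R :> R by rewrite ltr0n.
apply: ge_sup.
  exists ((\sum_(i < d) `|((0 : 'rV[int]_d) ord0 i)%:~R|) / d%:R); exists 0 =>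
    //.
  apply/hG => //; split; first by move=> i _; rewrite mxE.
  by rewrite big1// => i _; rewrite mxE absz0 muln0.
move=> _ [y /(hG _ kn) /weighted_ball_le hy <-].
rewrite powRN powR12_sqrt ?(ltW d0R)// ler_pdivrMr//.
rewrite -{2}(sqr_sqrtr (ltW d0R)) expr2 mulrA mulVf ?mul1r ?gt_eqF ?sqrtr_gt0//.
apply: (@le_trans _ _ (2 ^ k)%N%:R).
  apply: le_trans (_ : (\sum_(i < d) `|y ord0 i|)%N%:R <= _);
    last by rewrite ler_nat.
  by rewrite natr_sum; apply: ler_sum => i _; rewrite -intr_norm natr_absz.
rewrite -(@ler_pXn2r _ 2)// ?nnegrE ?sqrtr_ge0// sqr_sqrtr ?(ltW d0R)// -natrX
  ler_nat.
by apply: leq_trans hd; rewrite leq_exp2r// leq_exp2l// ltnW.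
Qed.

Local Notation E := (#|even_cube n d|).

Lemma lp_norm_even_ind p : 1 < p ->
  lp_norm p (cmod even_ind) = ((E%:R : R) `^ p^-1)%:E.
Proof.
move=> p1; have p0 : p != 0 by rewrite gt_eqF// (lt_trans ltr01).
rewrite /lp_norm -poweR_EFin; congr (_ `^ _)%E.
have ind x : (`|cmod even_ind x| `^ p = (in_even n x)%:R%:E)%E.
  rewrite /cmod /even_ind normc_nat.
  case: (in_even n x); rewrite /= ?normr1 ?normr0 ?powR1//.
  by rewrite powR0.
under eq_esum do rewrite ind.
rewrite (@esumT_supported _ _ (@cube_pt d @` [set g | g \in even_cube n d]));
  last first.
  move=> x; case: (boolP (in_even n x)) => // /existsP[g /andP[gE /eqP <-]] [].
  by exists g.
rewrite esum_image_finType//; last by move=> g h _ _; exact: cube_pt_inj.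
transitivity (\sum_(g in even_cube n d) (1%:E : \bar R))%E.
  apply: eq_bigr => g gE; rewrite (_ : in_even n (cube_pt g))//.
  by apply/existsP; exists g; rewrite gE eqxx.
by rewrite sumEFin sumr_const.
Qed.

(** The points [flip g (pivot md k)] are pairwise distinct over all [k] and all even [g]
    ([flip_pivot_inj]), and at each of them scale [2 ^+ k] already gives 1/3. *)
Lemma lp_norm_maximal_ge p : 1 < p ->
  ((((n * E)%:R * (3^-1 `^ p)) `^ p^-1)%:E <=
    lp_norm p (dyadic_small_maximal G even_ind))%E.
Proof.
move=> p1; have p0 : 0 < p := lt_trans ltr01 p1.
rewrite /lp_norm -poweR_EFin.
set S := esum _ _.
have S0 : (0 <= S)%E by apply: esum_ge0 => x _; exact: poweR_ge0.
apply: gt0_ler_poweR; rewrite ?invr_ge0 ?(ltW p0)// ?in_itv/= ?leey ?andbT//.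
pose e (kg : 'I_n * {ffun 'I_d -> bool}) := cube_pt (flip kg.2 (pivot md kg.1)).
apply: le_trans (le_esumT (e @` [set kg | kg.2 \in even_cube n d]) _);
  last first.
  by move=> x; exact: poweR_ge0.
rewrite esum_image_finType; last 2 first.
- by move=> x; exact: poweR_ge0.
- move=> kg lh kgE lhE /cube_pt_inj; exact: flip_pivot_inj.
apply: (@le_trans _ _ (\sum_(kg : 'I_n * {ffun 'I_d -> bool} | kg.2
  \in even_cube n d) (3^-1 `^ p)%:E)%E).
  rewrite sumEFin lee_fin sumr_const -[leRHS]mulr_natl; apply: ler_wpM2r;
    first exact: powR_ge0.
  rewrite ler_nat (_ : #|_| = #|predX (mem 'I_n) (mem (even_cube n d))|).
    by rewrite cardX card_ord.
  by apply: eq_card => kg; rewrite !inE.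
apply: lee_sum => -[k g] /= gE.
rewrite -poweR_EFin; apply: gt0_ler_poweR; rewrite ?(ltW p0)// ?in_itv/=
  ?leey ?andbT ?lee_fin ?abse_ge0//.
apply: le_trans (lee_abs _).
apply: (@le_trans _ _ (cmod (discrete_avg G (2 ^+ k) even_ind) (e (k, g)))).
  by rewrite lee_fin; exact: discrete_avg_even_ind_ge.
(* The supremum runs over integer exponents; at [Posz k] the integer power computes to [2 ^+ k]. *)
apply: ereal_sup_ubound; exists (Posz k) => //=.
exact: kappa_tilde_le.
Qed.

End maximal_lower_bound.

Theorem proposition1p6 (R : realType) (K : R) : 0 < K ->
  exists (d : nat) (G : set 'rV[R]_d) (f : 'rV[int]_d -> R[i]),
    [/\ (0 < d)%N,
        [/\ convex_body G, unconditional G & isotropic G],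
        (exists x, f x != 0),
        (forall p : R, 1 < p -> (lp_norm p (cmod f) < +oo)%E) &
        (forall p : R, 1 < p ->
          ((6^-1 * K `^ p^-1)%:E * lp_norm p (cmod f)
             <= lp_norm p (dyadic_small_maximal G f))%E)].
Proof.
move=> K0.
pose n := (Num.truncn K).+1.
have Kn : K <= n%:R by rewrite ltW// truncnS_gt.
(* The bound [B = 2 ^ n] covers the weights and scales of all [n] blocks, and [B ^ 2 <= d] becomes
   the hypothesis behind [kappa_tilde_le]. *)
have [||d [G [md hd hG hL]]] := @exists_needle_body R (block_start n)
  (fun i => 2 ^ block_of i)%N (2 ^ n).
- by rewrite expn_gt0.
- by move=> i im; rewrite expn_gt0/= leq_exp2l// ltnW// block_of_lt.
have hL' (k : nat) (y : 'rV[int]_d) : (k < n)%N ->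
    lattice_points (dilate (2 ^+ k) G) y <-> weighted_ball n k y.
  by move=> kn; rewrite -natrX; apply: hL; rewrite expn_gt0/= leq_exp2l// ltnW.
exists d, G, (@even_ind R n d); split => //.
- by apply: leq_trans hd; rewrite !expn_gt0.
- exists (cube_pt [ffun=> false]); rewrite /even_ind (_ : in_even _ _)
    ?oner_neq0//.
  by apply/existsP; exists [ffun=> false]; rewrite even_cube0 eqxx.
- by move=> p p1; rewrite lp_norm_even_ind// ltry.
move=> p p1; apply: le_trans (lp_norm_maximal_ge md hd hL' p1).
have p0 : 0 < p := lt_trans ltr01 p1.
(* The lower bound factors as [n^(1/p) * E^(1/p) / 3] with [E] the number of even points; it remains
   to use [K <= n] and 1/6 <= 1/3. *)
rewrite lp_norm_even_ind// -EFinM lee_fin powRM ?powR_ge0// natrM powRM//.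
rewrite -powRrM mulfV ?gt_eqF// powRr1// mulrC [leRHS]mulrAC [leRHS]mulrC.
rewrite ler_wpM2l ?powR_ge0// [leRHS]mulrC.
apply: ler_pM; rewrite ?powR_ge0//.
  by rewrite lef_pV2 ?posrE// ler_nat.
by apply: ge0_ler_powR; rewrite ?nnegrE ?invr_ge0 ?(ltW p0) ?(ltW K0).
Qed.
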